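(* Fix any distribution $P$ on $\mathcal{X}\times\mathbb{R}$, any symmetric regression algorithm $\mathcal{A}$, and any sample size $n\geq 1$. Assume that, for $(X,Y)\sim P$, the conditional distribution of $Y\mid X$ has density $f_{Y|X}(y\mid x)$ with respect to Lebesgue measure, and define \[B_{\mathrm{dens}} = \mathbb{E}\left[\sup_{y\in\mathbb{R}}f_{Y|X}(y\mid X)\right],\] where the expected value is taken with respect to the marginal distribution of $X$ under $P$. Then, for any $m\geq 1$ and any $\delta\in(0,1)$, \[\mathbb{P}\left\{ \alpha_P^{\text{J+}}(\mathcal{D}_n) < \alpha + 3\sqrt{\frac{\log(1/\delta)}{2\min\{n,m\}}} + 4\sqrt[4]{2B_{\mathrm{dens}}\cdot \beta_{m,n-1}^{\mathrm{out}}(\mathcal{A},P)} \right\} \geq 1 - 3\delta - \sqrt[4]{2B_{\mathrm{dens}}\cdot \beta_{m,n-1}^{\mathrm{out}}(\mathcal{A},P)},\] where the probability is taken with respect to $\mathcal{D}_n = \{(X_i,Y_i)\}_{i\in[n]}$ drawn i.i.d. from $P$.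
   Context: Write $[n]=\{1,\dots,n\}$. Let $\mathcal{X}$ be a measurable space. A regression algorithm is a map $\mathcal{A}:\bigcup_{n\geq 0}(\mathcal{X}\times\mathbb{R})^n\to\{\text{measurable functions }\mathcal{X}\to\mathbb{R}\}$. It is symmetric if for each $n\ge1$, each data set and each permutation $\pi$ of $[n]$, $\mathcal{A}((X_1,Y_1),\dots,(X_n,Y_n))=\mathcal{A}((X_{\pi(1)},Y_{\pi(1)}),\dots,(X_{\pi(n)},Y_{\pi(n)}))$. All quantities whose probabilities or expectations are taken are understood to be measurable. A target level $\alpha\in(0,1)$ is fixed. Quantile: for real $v_1,\dots,v_n$ and $\tau\in\mathbb{R}$, $\mathrm{Quantile}(\{v_i\}_{i\in[n]};\tau)=\inf\{t\in\mathbb{R}: \#\{i\in[n]: v_i\le t\}\ge \tau n\}$, equal to $+\infty$ if $\tau>1$. Jackknife+: given $\mathcal{D}_n=\{(X_i,Y_i)\}_{i\in[n]}$, let $\widehat\mu_{-i}=\mathcal{A}(\{(X_j,Y_j)\}_{j\in[n]\setminus\{i\}})$ and $R_i=|Y_i-\widehat\mu_{-i}(X_i)|$ for $i\in[n]$. The (uninflated) jackknife+ interval at $x$ is \[\widehat{C}^{\text{J+}}_n(x)=\Big[-\mathrm{Quantile}\big(\{-\widehat\mu_{-i}(x)+R_i\}_{i\in[n]};(1-\alpha)(1+1/n)\big),\ \mathrm{Quantile}\big(\{\widehat\mu_{-i}(x)+R_i\}_{i\in[n]};(1-\alpha)(1+1/n)\big)\Big]\] (as a subset of $\mathbb{R}$,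 empty if the lower endpoint exceeds the upper). Its training-conditional miscoverage rate is $\alpha_P^{\text{J+}}(\mathcal{D}_n)=\mathbb{P}\{Y_{n+1}\notin\widehat{C}^{\text{J+}}_n(X_{n+1})\mid\mathcal{D}_n\}$, where $(X_{n+1},Y_{n+1})\sim P$ is independent of $\mathcal{D}_n$. Out-of-sample $m$-stability: for $n,m\ge0$, $\beta^{\mathrm{out}}_{m,n}(\mathcal{A},P)=\mathbb{E}[|\widehat\mu_n(X)-\widehat\mu_{n+m}(X)|]$, where $\widehat\mu_k=\mathcal{A}((X_1,Y_1),\dots,(X_k,Y_k))$ and $(X_1,Y_1),\dots,(X_{n+m},Y_{n+m}),(X,Y)$ are i.i.d. from $P$. *)

(* Defs.v *)
From HB Require Import structures.
From mathcomp Require Export all_boot all_order all_algebra.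
From mathcomp Require Export all_classical all_reals all_analysis.
From mathcomp Require Export perm measurable_realfun.
Export Order.TTheory GRing.Theory Num.Theory.
Export numFieldNormedType.Exports.

Set Implicit Arguments.
Unset Strict Implicit.
Unset Printing Implicit Defensive.

Local Open Scope classical_set_scope.
Local Open Scope ring_scope.

Section iid_sample.
Context d (T : measurableType d) (R : realType).

Definition tuple_cons n (p : T * n.-tuple T) : n.+1.-tuple T :=
  [tuple of p.1 :: p.2].

Lemma measurable_tuple_cons n : measurable_fun setT (@tuple_cons n).
Proof. exact: measurable_cons. Qed.

HB.instance Definition _ n := isMeasurableFun.Build _ _
  (T * n.-tuple T)%type (n.+1.-tuple T) (@tuple_cons n)
  (@measurable_tuple_cons n).

(* The law P^n of an i.i.d. sample of size n from P; iid_law_box below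
   characterizes it. *)
Fixpoint iid_law (P : probability T R) n : probability (n.-tuple T) R :=
  match n with
  | 0 => dirac [tuple]
  | k.+1 => distribution (P \x iid_law P k)%E (@tuple_cons k)
  end.

Lemma iid_law_box (P : probability T R) n (B : 'I_n -> set T) :
  (forall i, measurable (B i)) ->
  iid_law P n [set D | forall i, B i (tnth D i)] = (\prod_(i < n) P (B i))%E.
Proof.
elim: n B => [|n IHn] B mB /=.
  rewrite big_ord0 diracE mem_set//=; by case.
rewrite big_ord_recl -IHn//.
rewrite /distribution /pushforward /=.
rewrite -product_measure1E//; last first.
  rewrite (_ : mkset _ = \bigcap_(i in [set: 'I_n])
    ((@tnth _ T ^~ i) @^-1` B (lift ord0 i))).
    apply: fin_bigcap_measurable => [|i _]; first exact: finite_finset.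
    rewrite -[X in measurable X]setTI.
    exact: (measurable_tnth (T := T) i measurableT).
  apply/seteqP; split=> [D /= DB i _ /=|D /= DB i]; first exact: DB.
  exact: DB.
congr (product_measure1 _ _ _); apply/seteqP; split => -[x D] /= h.
  split; first by have := h ord0; rewrite tnth0.
  by move=> i; have := h (lift ord0 i); rewrite tnthS.
by move=> i; case: (unliftP ord0 i) => [j ->|->];
  rewrite ?tnthS ?tnth0; case: h => // h1; apply.
Qed.

End iid_sample.

Section conditional_density.
Context d (X : measurableType d) (R : realType).

HB.instance Definition _ := isMeasurableFun.Build _ _
  (X * R)%type X fst measurable_fst.

Definition marginalX (P : probability (X * R)%type R) : probability X R :=
  distribution P (fst : {mfun (X * R)%type >-> X}).

Definition conditional_distribution (P : probability (X * R)%type R)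
    (kappa : R.-pker X ~> R) : Prop :=
  forall (A : set X) (B : set R), measurable A -> measurable B ->
    P (A `*` B) = (\int[marginalX P]_(x in A) kappa x B)%E.

(* [f x y] stands for f_{Y|X}(y | x). *)
Definition conditional_density (P : probability (X * R)%type R)
    (f : X -> R -> R) : Prop :=
  [/\ forall x y, 0 <= f x y,
      forall x, measurable_fun setT (f x) &
      exists2 kappa : R.-pker X ~> R, conditional_distribution P kappa &
        {ae marginalX P, forall x, forall B : set R, measurable B ->
          kappa x B = (\int[lebesgue_measure]_(y in B) (f x y)%:E)%E}].

Definition sup_density (f : X -> R -> R) (x : X) : \bar R :=
  ereal_sup (range (fun y => (f x y)%:E)).

Definition B_dens (P : probability (X * R)%type R) (f : X -> R -> R) : \bar R :=
  (\int[marginalX P]_x sup_density f x)%E.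

End conditional_density.

Section regression.
Context d (X : measurableType d) (R : realType).

Definition regression_algorithm := seq (X * R) -> {mfun X >-> R}.

Definition symmetric_algorithm (A : regression_algorithm) : Prop :=
  forall n (D : n.-tuple (X * R)) (s : {perm 'I_n}),
    A D = A [tuple tnth D (s i) | i < n].

(* Ensures that all the events and integrands below are measurable. *)
Definition jointly_measurable (A : regression_algorithm) : Prop :=
  forall k, measurable_fun setT
    (fun p : k.-tuple (X * R) * X => A p.1 p.2 : R).

Definition quantile n (v : 'I_n -> R) (tau : R) : \bar R :=
  if 1 < tau then +oo%E else
  ereal_inf [set t%:E | t in
    [set t : R | tau * n%:R <= #|[pred i | v i <= t]|%:R]].

Definition leave_one_out (A : regression_algorithm) n
    (D : n.-tuple (X * R)) (i : 'I_n) : {mfun X >-> R} :=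
  A [seq tnth D j | j <- enum 'I_n & j != i].

Definition loo_residual (A : regression_algorithm) n
    (D : n.-tuple (X * R)) (i : 'I_n) : R :=
  `|(tnth D i).2 - leave_one_out A D i (tnth D i).1|.

Definition jackknife_plus (A : regression_algorithm) (alpha : R) n
    (D : n.-tuple (X * R)) (x : X) : set R :=
  let tau := (1 - alpha) * (1 + n%:R^-1) in
  let lo := quantile
    (fun i => - (leave_one_out A D i x : R) + loo_residual A D i) tau in
  let hi := quantile
    (fun i => (leave_one_out A D i x : R) + loo_residual A D i) tau in
  [set y : R | (- lo <= y%:E <= hi)%E].

(* As the test point is independent of the training data, its conditional law
   given D is P. *)
Definition miscoverage (P : probability (X * R)%type R)
    (A : regression_algorithm) (alpha : R) n (D : n.-tuple (X * R)) : \bar R :=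
  P [set z | ~ jackknife_plus A alpha D z.1 z.2].

Definition beta_out (P : probability (X * R)%type R)
    (A : regression_algorithm) (m n : nat) : \bar R :=
  (\int[iid_law P (n + m) \x P]_p
     `|A (take n p.1) p.2.1 - A p.1 p.2.1|%:E)%E.

End regression.

(* Main.v *)
From HB Require Import structures.
Require Import Defs.
From mathcomp Require Import ring lra.

(** Extend the training sample by [m] further independent points of [P]. These
    points play two roles.

    On the one hand they are test points: given the training sample, the
    fraction of them that the interval misses is within [t] of the miscoverage
    rate, by Hoeffding's inequality ([hoeffding_iid]), where [t] is the square
    root in the theorem.

    On the other hand they complete the training sample to [N = n + m] points,
    whose leave-one-out residuals [r_k], each computed from a fit on the [N - 1]
    other points, are exchangeable because the algorithm is symmetric: given the
    unordered sample, the training points are drawn from it without replacement.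
    Let [p = alpha + s + t]. By Hoeffding's inequality for such draws
    ([hoeffding_without_replacement]), less than a fraction [p + t] of the test
    points are among the fraction [p] of the points with the largest residuals
    ([upper]), and less than a fraction [1 - p + t] of the training points are
    among those below some other point ([lower]). So a test point whose residual
    exceeds those of a fraction [1 - alpha - s] of the training points is among
    the largest ones, and less than a fraction [p + t] of the test points are of
    this kind ([count_miss_lt]). The three uses of Hoeffding's inequality cost
    [3 * t] in the rate and [3 * delta] in the probability.

    It remains to compare the residuals that define the interval with the [r_k].
    A test point [j] outside of the interval inflated by [eps] has [R_i + eps <
    |Y_j - mu_i(X_j)|] for at least [(1 - alpha) * n] of the training points
    [i], where [mu_i] is the fit on the [n - 1] other training points. The fits
    defining [r_i] and [r_j] are trained on these [n - 1] points and on [m]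
    more, and are evaluated at points that they are not trained on. Hence the
    error on the residual of [i] and the one on that of [j] have mean at most
    [beta = beta_out P A m n.-1] ([integral_instability]), and [r_i < r_j]
    unless their sum exceeds [eps], which has probability at most [2 * beta /
    eps]. Conversely, the inflation changes the miscoverage rate by at most [2 *
    eps * B], where [B = B_dens P f] ([miscoverage_le_inflated]).

    Let [g = (2 * B * beta) `^ (1 / 4)], [s = g] and [eps = beta / g ^+ 3]. By
    Markov's inequality, the probability that for more than a fraction [2 * g]
    of the test points the comparison fails with more than a fraction [g] of the
    training points is at most [g]. The rate then increases by [s = g], by [2 *
    g] for those test points, and by [2 * eps * B = g] for the inflation: in
    total [4 * g]. If [beta = 0] no inflation is needed, and if [2 * B * beta]
    is infinite there is nothing to prove. *)

Set Implicit Arguments.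
Unset Strict Implicit.
Unset Printing Implicit Defensive.

Local Open Scope classical_set_scope.
Local Open Scope ring_scope.

Lemma le_of_eq (disp : Order.disp_t) (T : porderType disp) (x y : T) :
  x = y -> (x <= y)%O.
Proof. by move=> ->. Qed.

(** * The moment generating function of a Bernoulli variable *)

Section bernoulli_mgf.
Context {R : realType} (p : R) (p01 : 0 <= p <= 1).

Let mgf (x : R) : R := 1 - p + p * expR x.

Let mgf_gt0 x : 0 < mgf x.
Proof.
rewrite /mgf; case/andP: p01 => p0 p1; have := expR_gt0 x => e0.
have [->|pn] := eqVneq p 0; first by rewrite mul0r addr0 subr0.
have : 0 < p * expR x by rewrite mulr_gt0// lt_neqAle eq_sym pn.
lra.
Qed.

Let is_derive_mgf (x : R) : is_derive x 1 mgf (p * expR x).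
Proof.
rewrite /mgf; apply: is_derive_eq; rewrite /GRing.scale/=; ring.
Qed.

Let tilt (x : R) : R := p * expR x * (mgf x)^-1.

Let is_derive_tilt (x : R) : is_derive x 1 tilt (tilt x * (1 - tilt x)).
Proof.
have m0 := lt0r_neq0 (mgf_gt0 x).
have dm := @is_deriveV R mgf x _ 1 m0 (is_derive_mgf x).
rewrite /tilt; apply: is_derive_eq.
rewrite /GRing.scale/=; move: m0; rewrite /mgf => m0; field.
exact: m0.
Qed.

Let tilt_le x : 0 <= x -> tilt x <= p + x / 4.
Proof.
move=> x0; rewrite -subr_ge0.
pose g (x : R) : R := p + x / 4 - tilt x.
have dg (y : R) : is_derive y 1 g (4^-1 - tilt y * (1 - tilt y)).
  have dt := is_derive_tilt y.
  rewrite /g; apply: is_derive_eq; rewrite /GRing.scale/=.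
  ring.
rewrite [leLHS](_ : 0 = g 0); last first.
  rewrite /g /tilt /mgf expR0; field; lra.
rewrite -/(g x).
apply: (@ger0_derive1_ndecr _ g 0 x) => //.
- move=> y _; rewrite derive1E; have [_ ->] := dg y.
  have : 0 <= (tilt y - 1/2) ^+ 2 by rewrite sqr_ge0.
  nra.
- by apply: continuous_subspaceT => y;
    apply/differentiable_continuous/derivable1_diffP; have [h1 h2] := dg y;
    exact: h1.
Qed.

(** The difference of the logarithms of the two sides vanishes at [0] and has
    derivative [p + x / 4 - tilt x], where [tilt x] is the mean of the variable
    under the exponentially tilted law; that mean starts at [p] and grows at the
    rate [tilt x * (1 - tilt x)], a variance, hence at most [1 / 4]. *)
Lemma bernoulli_mgf_le (x : R) : 0 <= x ->
  1 - p + p * expR x <= expR (x * p + x ^+ 2 / 8).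
Proof.
move=> x0; rewrite -/(mgf x) -[leLHS]lnK ?posrE// ler_expR -subr_ge0.
pose g (x : R) : R := x * p + x ^+ 2 / 8 - ln (mgf x).
have dg (y : R) : is_derive y 1 g (p + y / 4 - tilt y).
  have dl := @is_derive1_ln _ _ (mgf_gt0 y).
  have dc := @is_derive1_comp _ (@ln R) mgf y _ _ dl (is_derive_mgf y).
  rewrite /g; apply: is_derive_eq; rewrite /tilt /GRing.scale/=; field.
  by rewrite gt_eqF.
rewrite [leLHS](_ : 0 = g 0); last first.
  by rewrite /g /mgf expR0 mulr1 subrK ln1; ring.
rewrite -/(g x).
apply: (@ger0_derive1_ndecr _ g 0 x) => //.
- move=> y; rewrite in_itv/= => /andP[y0 _]; rewrite derive1E;
    have [_ ->] := dg y.
  by rewrite subr_ge0 tilt_le// ltW.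
- by apply: continuous_subspaceT => y;
    apply/differentiable_continuous/derivable1_diffP; have [h1 h2] := dg y;
    exact: h1.
Qed.

End bernoulli_mgf.

(** * Hoeffding's inequality for sampling without replacement *)

(** Sums over the uniform law on [T] of two oppositely ordered functions: the
    double sum of [(f a - f b) * (g a - g b)] expands to twice the difference of
    the two sides. *)
Lemma chebyshev_sum (R : realFieldType) (T : finType) (f g : T -> R) :
  (forall a b, (f a - f b) * (g a - g b) <= 0) ->
  #|T|%:R * (\sum_a f a * g a) <= (\sum_a f a) * (\sum_a g a).
Proof.
move=> fg; have : \sum_a \sum_b (f a - f b) * (g a - g b) <= 0.
  by apply: sumr_le0 => a _; apply: sumr_le0.
rewrite (eq_bigr (fun a => #|T|%:R * (f a * g a) + \sum_b f b * g b
    - f a * (\sum_b g b) - g a * (\sum_b f b))); last first.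
  move=> a _; rewrite (eq_bigr (fun b => f a * g a + f b * g b - f a * g b
    - g a * f b)); last by move=> b _; ring.
  by rewrite !sumrB big_split/= sumr_const -!mulr_sumr mulr_natl.
rewrite !sumrB big_split/= -mulr_sumr -!mulr_suml sumr_const -mulr_natl.
lra.
Qed.

Section sampling_without_replacement.
Context {R : realType} (N : nat) (U : {set 'I_N}).

Let u (j : 'I_N) : R := (j \in U)%:R.

Let sum_u (s : 'S_N) : \sum_b u (s b) = #|U|%:R.
Proof.
rewrite -(reindex_inj (@perm_inj _ s) (P := predT) (F := u))/=.
rewrite /u -natr_sum -sum1_card [in RHS]big_mkcond; congr _%:R.
Qed.

(** Exchanging the positions [a] and [b] leaves the draws at [l] unchanged. *)
Let swap_draws (G : R -> R) (l : seq 'I_N) (a b : 'I_N) :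
  a \notin l -> b \notin l ->
  \sum_(s : 'S_N) G (\sum_(i <- l) u (s i)) * u (s a) =
  \sum_(s : 'S_N) G (\sum_(i <- l) u (s i)) * u (s b).
Proof.
move=> al bl; rewrite (reindex_inj (mulgI (tperm a b))).
apply: eq_bigr => s _; rewrite permM tpermL; congr (G _ * _).
rewrite !big_seq; apply: eq_bigr => i il; rewrite permM tpermD//.
  by apply: contraNneq al => ->.
by apply: contraNneq bl => ->.
Qed.

(** By [swap_draws], the next draw may be averaged over all the positions
    outside [l]: given the draws at [l], it hits [U] with a probability
    proportional to what is left of [U]. *)
Let sum_draw (G : R -> R) (l : seq 'I_N) (a : 'I_N) : uniq (a :: l) ->
  (N - size l)%:R * (\sum_(s : 'S_N) G (\sum_(i <- l) u (s i)) * u (s a)) =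
  \sum_(s : 'S_N) G (\sum_(i <- l) u (s i)) *
    (#|U|%:R - \sum_(i <- l) u (s i)).
Proof.
move=> /= /andP[al ul].
transitivity (\sum_(b | b \notin l)
    \sum_(s : 'S_N) G (\sum_(i <- l) u (s i)) * u (s a)).
  rewrite sumr_const mulr_natl; congr (_ *+ _).
  have := cardC (mem l); rewrite card_ord (card_uniqP ul) => cN.
  have /(congr1 (subn^~ (size l))) := cN; rewrite /= addKn => <-.
  exact: eq_card.
rewrite (eq_bigr _ (fun b bl => swap_draws G al bl)) exchange_big/=.
apply: eq_bigr => s _; rewrite -mulr_sumr -(sum_u s); congr (_ * _).
by rewrite (bigID (mem l) predT)/= (big_uniq _ ul)/= addrAC subrr add0r.
Qed.

(** Each new draw multiplies the moment generating function by at most the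
    Bernoulli factor of a draw with replacement: the more elements of [U] have
    been drawn, the fewer are left, so that [chebyshev_sum] applies to [expR (x
    * F s)] and to the chance [#|U| - F s] of drawing a new one. *)
Lemma mgf_without_replacement (x : R) (l : seq 'I_N) : 0 <= x -> uniq l ->
  \sum_(s : 'S_N) expR (x * \sum_(i <- l) u (s i)) <=
  N`!%:R * (1 - #|U|%:R / N%:R + #|U|%:R / N%:R * expR x) ^+ size l.
Proof.
move=> x0; have cardS : #|{: 'S_N}| = N`! by rewrite card_Sn.
elim: l => [_|a l IH ual] /=.
  under eq_bigr do rewrite big_nil mulr0 expR0.
  by rewrite sumr_const cardS expr0 mulr1.
have /andP[al ul] := ual.
set q := #|U|%:R / N%:R.
have N0 : (0 < N)%N by apply: leq_ltn_trans (ltn_ord a).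
have q0 : 0 <= q by rewrite divr_ge0.
have q1 : q <= 1.
  by rewrite ler_pdivrMr ?ltr0n// mul1r ler_nat -[leqRHS]card_ord max_card.
have c0 : (0 < N - size l)%N.
  have := max_card (mem (a :: l)); rewrite card_ord (card_uniqP ual)/=.
  by rewrite subn_gt0.
pose F (s : 'S_N) := \sum_(i <- l) u (s i).
have draw : \sum_(s : 'S_N) expR (x * F s) * u (s a)
    <= q * \sum_(s : 'S_N) expR (x * F s).
  have /= := @chebyshev_sum _ _ (fun s : 'S_N => expR (x * F s))
    (fun s => #|U|%:R - F s).
  rewrite cardS -(sum_draw (fun y => expR (x * y)) ual) => cheb.
  have Eu : N%:R * (\sum_(s : 'S_N) u (s a)) = N`!%:R * #|U|%:R.
    have := @sum_draw (fun=> 1) [::] a erefl; rewrite /= subn0.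
    under eq_bigr do rewrite mul1r.
    move=> ->; under eq_bigr do rewrite big_nil mul1r subr0.
    by rewrite sumr_const cardS mulr_natl.
  have EF : \sum_(s : 'S_N) (#|U|%:R - F s) = (N - size l)%:R * (N`!%:R * q).
    transitivity ((N - size l)%:R * \sum_(s : 'S_N) u (s a)).
      have := sum_draw (fun=> 1) ual; under eq_bigr do rewrite mul1r.
      by move=> ->; apply: eq_bigr => s _; rewrite mul1r.
    congr (_ * _); rewrite /q mulrA -Eu mulrAC mulfV ?mul1r//.
    by rewrite pnatr_eq0 -lt0n.
  rewrite EF in cheb.
  have := cheb _; rewrite -/(F _) => {}cheb.
  rewrite -(ler_pM2l (_ : 0 < N`!%:R * (N - size l)%:R)); last first.
    by rewrite -natrM ltr0n muln_gt0 fact_gt0.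
  rewrite -mulrA (le_trans (cheb _))//.
    move=> s1 s2; have [le12|/ltW le21] := leP (F s1) (F s2).
      by rewrite mulr_le0_ge0 ?subr_le0 ?ler_expR ?ler_wpM2l//; lra.
    by rewrite mulr_ge0_le0 ?subr_ge0 ?ler_expR ?ler_wpM2l//; lra.
  apply: le_of_eq; ring.
rewrite (eq_bigr (fun s : 'S_N =>
    expR (x * F s) + (expR x - 1) * (expR (x * F s) * u (s a)))); last first.
  move=> s _; rewrite big_cons -/(F s) mulrDr expRD /u.
  by case: (s a \in U); rewrite /= ?mulr1 ?mulr0 ?expR0; ring.
rewrite big_split/= -mulr_sumr.
have ex1 : 0 <= expR x - 1 by rewrite subr_ge0 -expR0 ler_expR.
apply: (@le_trans _ _ ((1 - q + q * expR x) * \sum_(s : 'S_N) expR (x * F s))).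
  rewrite (_ : (1 - q + q * expR x) * _ = \sum_(s : 'S_N) expR (x * F s) +
    (expR x - 1) * (q * \sum_(s : 'S_N) expR (x * F s))); last ring.
  by rewrite lerD2l ler_wpM2l.
rewrite exprS mulrCA ler_wpM2l ?IH//.
by rewrite addr_ge0 ?subr_ge0// mulr_ge0// expR_ge0.
Qed.

(** A uniformly random permutation makes, at the positions [I], draws without
    replacement. Chernoff's method applies as for independent draws. *)
Lemma hoeffding_without_replacement (I : {set 'I_N}) (p t : R) :
  #|U|%:R <= p * N%:R -> 0 <= t ->
  #|[set s : 'S_N | #|I|%:R * (p + t) <= \sum_(i in I) (s i \in U)%:R]|%:R <=
  expR (- (2 * #|I|%:R * t ^+ 2)) * N`!%:R.
Proof.
move=> Up t0; set E := [set s | _].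
have [I0|I0] := posnP #|I|.
  rewrite I0 mulr0 mul0r oppr0 expR0 mul1r ler_nat.
  by rewrite (leq_trans (max_card _))// card_Sn.
have N0 : (0 < N)%N by rewrite (leq_trans I0)// -[leqRHS]card_ord max_card.
pose q : R := #|U|%:R / N%:R.
have q0 : 0 <= q by rewrite divr_ge0.
have q1 : q <= 1.
  by rewrite ler_pdivrMr ?ltr0n// mul1r ler_nat -[leqRHS]card_ord max_card.
have qp : q <= p by rewrite ler_pdivrMr ?ltr0n.
(* The exponent that minimizes the Chernoff bound. *)
pose x := 4 * t.
have x0 : 0 <= x by rewrite mulr_ge0.
rewrite -(ler_pM2l (expR_gt0 (x * (#|I|%:R * (p + t))))).
apply: (@le_trans _ _ (\sum_(s : 'S_N) expR (x * \sum_(i <- enum I) u (s i)))).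
  rewrite -[#|E|]sum1_card natr_sum mulr_sumr [leRHS](bigID (mem E))/=.
  rewrite -[leLHS]addr0 lerD//; last by apply: sumr_ge0 => s _; exact: expR_ge0.
  apply: ler_sum => s; rewrite inE => Es; rewrite mulr1 ler_expR ler_wpM2l//.
  by rewrite big_enum.
apply: (le_trans (mgf_without_replacement x0 (enum_uniq _))).
rewrite -cardE [leRHS]mulrA -expRD [leRHS]mulrC ler_wpM2l//.
apply: (@le_trans _ _ (expR (x * q + x ^+ 2 / 8) ^+ #|I|)).
  by rewrite ler_pXn2r ?nnegrE ?expR_ge0 ?bernoulli_mgf_le ?q0// addr_ge0
    ?subr_ge0// mulr_ge0// expR_ge0.
rewrite -expRM_natl ler_expR.
rewrite [leRHS](_ : _ = #|I|%:R * (x * p + x ^+ 2 / 8)).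
  by rewrite ler_wpM2l// lerD2r ler_wpM2l.
by rewrite /x; field.
Qed.

End sampling_without_replacement.

(** * Laws of i.i.d. samples *)

Section product_law.
Context d (T : measurableType d) (R : realType) (P : probability T R).

Definition box n (B : 'I_n -> set T) : set (n.-tuple T) :=
  [set D | forall i, B i (tnth D i)].

Lemma measurable_box n (B : 'I_n -> set T) :
  (forall i, measurable (B i)) -> measurable (box B).
Proof.
move=> mB; rewrite (_ : box B = \bigcap_(i in [set: 'I_n])
    ((@tnth _ T ^~ i) @^-1` B i)).
  apply: fin_bigcap_measurable => [|i _]; first exact: finite_finset.
  by rewrite -[X in measurable X]setTI; exact: measurable_tnth.
by apply/seteqP; split=> [D DB i _|D DB i]; exact: DB.
Qed.

(** Boxes form a pi-system that generates the product sigma-algebra, and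
    [iid_law_box] gives the law of a box. *)
Lemma iid_law_unique n (mu : {measure set (n.-tuple T) -> \bar R}) :
  (forall B, (forall i, measurable (B i)) ->
    mu (box B) = (\prod_(i < n) P (B i))%E) ->
  forall E, measurable E -> mu E = iid_law P n E.
Proof.
move=> muE E mE; apply/esym.
pose G : set (set (n.-tuple T)) :=
  [set C | exists2 B, (forall i, measurable (B i)) & C = box B].
apply: (measure_unique G (fun=> setT)) => //.
- apply/seteqP; split.
    apply: smallest_sub; first exact: smallest_sigma_algebra.
    move=> C; rewrite -bigcup_seq => -[i _ [B mB <-]].
    rewrite setTI; apply: sub_sigma_algebra.
    exists (fun j => if j == i then B else setT).
      by move=> j; case: ifP => // _; exact: measurableT.
    apply/seteqP; split=> [D DB j|D DB] /=.
      by case: eqP => // ->.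
    by have := DB i; rewrite eqxx.
  apply: smallest_sub; first exact: sigma_algebra_measurable.
  by move=> _ [B mB ->]; exact: measurable_box.
- move=> _ _ [B mB ->] [C mC ->]; exists (fun i => B i `&` C i).
    by move=> i; exact: measurableI.
  by apply/seteqP; split=> [D [DB DC] i|D DBC]; split=> //;
    move=> i; have [] := DBC i.
- move=> _; exists (fun=> setT) => //.
  by apply/seteqP; split.
- by rewrite bigcup_const//; exists 0%N.
- move=> _ [B mB ->]; rewrite muE//. exact: iid_law_box.
- by move=> _; rewrite (le_lt_trans (probability_le1 _ _)) ?ltry.
Qed.

(** Permutations, initial segments and single coordinates of a sample are all
    instances. *)
Definition subsample n m (s : 'I_m -> 'I_n) (D : n.-tuple T) : m.-tuple T :=
  [tuple tnth D (s i) | i < m].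

Lemma take_subsample n m (D : (n + m).-tuple T) :
  take n D = subsample (lshift m) D.
Proof.
rewrite -[in LHS](map_tnth_enum D) -map_take /=.
have -> : take n (enum 'I_(n + m)) = [seq lshift m i | i <- enum 'I_n].
  apply: (inj_map val_inj); rewrite map_take val_enum_ord -map_comp.
  rewrite (_ : iota 0 (n + m) = iota 0 n ++ iota n m) ?iotaD//.
  by rewrite take_size_cat ?size_iota// -[LHS]val_enum_ord; apply: eq_map.
by rewrite -map_comp.
Qed.

Lemma measurable_subsample n m (s : 'I_m -> 'I_n) :
  measurable_fun setT (subsample s).
Proof.
apply/measurable_fun_tnthP => i.
rewrite (_ : _ \o _ = fun D => tnth D (s i)); first exact: measurable_tnth.
by apply/funext => D /=; rewrite tnth_mktuple.
Qed.

HB.instance Definition _ n m s := isMeasurableFun.Build _ _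
  (n.-tuple T) (m.-tuple T) (subsample s) (measurable_subsample s).

(** The preimage of a box is a box whose sides outside of the range of [s] are
    full. Exchangeability of the sample is the case of a permutation. *)
Lemma iid_law_subsample n m (s : 'I_m -> 'I_n) (E : set (m.-tuple T)) :
  injective s -> measurable E ->
  iid_law P n (subsample s @^-1` E) = iid_law P m E.
Proof.
move=> sI mE.
apply: (iid_law_unique (mu := distribution (iid_law P n) (subsample s))) => //.
move=> B mB; rewrite /distribution /pushforward /=.
pose C (j : 'I_n) := if [pick i | s i == j] is Some i then B i else setT.
have Cs i : C (s i) = B i.
  rewrite /C; case: pickP => [i' /eqP/sI->//|/(_ i)]; by rewrite eqxx.
transitivity (iid_law P n (box C)).
  congr (iid_law P n _).
  apply/seteqP; split=> [D /= DB j|D /= DC i].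
    rewrite /C; case: pickP => // i /eqP <-.
    by have := DB i; rewrite tnth_mktuple.
  by rewrite tnth_mktuple -Cs.
rewrite /box iid_law_box; last first.
  by move=> j; rewrite /C; case: pickP => // _ _; exact: measurableT.
rewrite (bigID (mem (codom s)))/= [X in (_ * X)%E]big1 ?mule1; last first.
  move=> j /negP sj; rewrite /C; case: pickP => [i /eqP ij|_].
    by case: sj; rewrite -ij codom_f.
  exact: probability_setT.
rewrite -big_uniq; last by rewrite codomE map_inj_uniq ?enum_uniq.
rewrite codomE big_map big_enum/=.
by apply: eq_bigr => i _; rewrite Cs.
Qed.

Definition tuple_cat n m (p : n.-tuple T * m.-tuple T) : (n + m).-tuple T :=
  [tuple of p.1 ++ p.2].

Lemma tnth_tuple_cat_l n m (p : n.-tuple T * m.-tuple T) i :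
  tnth (tuple_cat p) (lshift m i) = tnth p.1 i.
Proof. exact: tnth_lshift. Qed.

Lemma tnth_tuple_cat_r n m (p : n.-tuple T * m.-tuple T) i :
  tnth (tuple_cat p) (rshift n i) = tnth p.2 i.
Proof. exact: tnth_rshift. Qed.

Lemma measurable_tuple_cat n m : measurable_fun setT (@tuple_cat n m).
Proof.
apply/measurable_fun_tnthP => i; case: (split_ordP i) => j ->.
  rewrite (_ : _ \o _ = fun p : n.-tuple T * m.-tuple T => tnth p.1 j).
    by apply: (measurableT_comp (measurable_tnth j)) => //.
  by apply/funext => p /=; rewrite tnth_tuple_cat_l.
rewrite (_ : _ \o _ = fun p : n.-tuple T * m.-tuple T => tnth p.2 j).
  by apply: (measurableT_comp (measurable_tnth j)) => //.
by apply/funext => p /=; rewrite tnth_tuple_cat_r.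
Qed.

HB.instance Definition _ n m := isMeasurableFun.Build _ _
  (n.-tuple T * m.-tuple T)%type ((n + m).-tuple T) (@tuple_cat n m)
  (@measurable_tuple_cat n m).

Lemma iid_law_cat n m (E : set ((n + m).-tuple T)) : measurable E ->
  (iid_law P n \x iid_law P m)%E (@tuple_cat n m @^-1` E) = iid_law P (n + m) E.
Proof.
move=> mE; apply: (iid_law_unique (mu := distribution
  (iid_law P n \x iid_law P m)%E (@tuple_cat n m))) => //.
move=> B mB; rewrite /distribution /pushforward /=.
rewrite big_split_ord/= -!iid_law_box//.
transitivity ((iid_law P n \x iid_law P m)%E
    (box (fun i => B (lshift m i)) `*` box (fun i => B (rshift n i)))).
  congr ((iid_law P n \x iid_law P m)%E _).
  apply/seteqP; split=> [p /= pB|p /= [pB1 pB2] i].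
    split=> i; first by have := pB (lshift m i); rewrite tnth_tuple_cat_l.
    by have := pB (rshift n i); rewrite tnth_tuple_cat_r.
  case: (split_ordP i) => j ->.
    by rewrite tnth_tuple_cat_l; exact: pB1.
  by rewrite tnth_tuple_cat_r; exact: pB2.
by rewrite product_measure1E//; exact: measurable_box.
Qed.

Lemma ge0_integral_subsample n m (s : 'I_m -> 'I_n) (h : m.-tuple T -> \bar R) :
  injective s -> measurable_fun setT h -> (forall D, (0 <= h D)%E) ->
  (\int[iid_law P n]_D h (subsample s D) = \int[iid_law P m]_D h D)%E.
Proof.
move=> sI mh h0; have := @ge0_integral_distribution _ _ _ _ _
  (iid_law P n) (subsample s) h mh h0.
move=> <-; apply: eq_measure_integral => E mE _.
exact: iid_law_subsample.
Qed.

Lemma ge0_integral_cons n (h : n.+1.-tuple T -> \bar R) :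
  measurable_fun setT h -> (forall D, (0 <= h D)%E) ->
  (\int[iid_law P n.+1]_D h D =
   \int[P]_z \int[iid_law P n]_D h (tuple_cons (z, D)))%E.
Proof.
move=> mh h0 /=; rewrite ge0_integral_distribution//.
rewrite fubini_tonelli1//; last by move=> x; exact: h0.
by apply: (measurableT_comp mh); exact: measurable_tuple_cons.
Qed.

End product_law.

(** * Tail bounds for events about a sample *)

Section boolean_events.
Context d (T : measurableType d) (R : realType).

Lemma measurable_event (b : T -> bool) :
  measurable_fun setT b -> measurable [set x | b x].
Proof.
move=> mb; have := mb measurableT [set true] I; rewrite setTI.
by congr (measurable _); apply/seteqP; split.
Qed.

Lemma measurable_natr (b : T -> bool) :
  measurable_fun setT b -> measurable_fun setT (fun x => (b x)%:R : R).
Proof.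
move=> mb; rewrite (_ : (fun _ => _) = (fun x => if b x then 1 else 0)).
  exact: measurable_fun_ifT.
by apply/funext => x; case: (b x).
Qed.

Lemma measurable_count (I : Type) (r : seq I) (b : I -> T -> bool) :
  (forall i, measurable_fun setT (b i)) ->
  measurable_fun setT (fun x => \sum_(i <- r) (b i x)%:R : R).
Proof. by move=> mb; apply: measurable_sum => i; exact: measurable_natr. Qed.

Lemma measurable_exists (I : finType) (b : I -> T -> bool) :
  (forall i, measurable_fun setT (b i)) ->
  measurable_fun setT (fun x => [exists i, b i x]).
Proof.
move=> mb; rewrite (_ : (fun _ => _) =
    (fun x => 0 < \sum_(i <- index_enum I) (b i x)%:R :> R)).
  by apply: measurable_fun_ltr => //; exact: measurable_count.
apply/funext => x; apply/existsP/idP => [[i bi]|].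
  by rewrite (bigD1 i)//= bi ltr_pwDl// sumr_ge0.
rewrite lt0r => /andP[+ _]; apply: contraPP => nb; apply/negP.
rewrite negbK psumr_eq0//; apply/allP => i _; rewrite pnatr_eq0 eqb0.
by apply/negP => bi; apply: nb; exists i.
Qed.

Variable mu : {measure set T -> \bar R}.

Lemma measure_event (b : T -> bool) : measurable_fun setT b ->
  (mu [set x | b x] = \int[mu]_x ((b x)%:R : R)%:E)%E.
Proof.
move=> mb; rewrite -[X in mu X]setIT -integral_indic//;
  last exact: measurable_event.
by apply: eq_integral => x _; rewrite indicE mem_setE; congr (_%:R%:E)%E.
Qed.

Lemma markov_event (b : T -> bool) (g : T -> \bar R) (c : R) :
  measurable_fun setT b -> measurable_fun setT g -> (forall x, 0 <= g x)%E ->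
  0 <= c -> (forall x, b x -> (c%:E <= g x)%E) ->
  (c%:E * mu [set x | b x] <= \int[mu]_x g x)%E.
Proof.
move=> mb mg g0 c0 bg; rewrite measure_event// -ge0_integralZl_EFin//;
  last first.
  by apply/measurable_EFinP; exact: measurable_natr.
apply: ge0_le_integral => //.
- by move=> x _; rewrite -EFinM lee_fin mulr_ge0.
- by apply: measurable_funeM; apply/measurable_EFinP; exact: measurable_natr.
by move=> x _; case: (boolP (b x)) => [/bg|_]; rewrite ?mule1 ?mule0.
Qed.

End boolean_events.

Section exchangeability.
Context d (T : measurableType d) (R : realType) (P : probability T R).

(** By exchangeability the event has the same probability as each of its
    reorderings, so its probability is the expected proportion of the
    reorderings of the sample that satisfy it. This conditions on the unordered
    sample. *)
Lemma iid_law_le_permutations n (b : n.-tuple T -> bool) (c : R) :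
  measurable_fun setT b ->
  (forall D, #|[set s : 'S_n | b (subsample s D)]%SET|%:R <= c * n`!%:R) ->
  (iid_law P n [set D | b D] <= c%:E)%E.
Proof.
move=> mb bc.
have mbs (s : 'S_n) : measurable_fun setT (fun D => b (subsample s D)).
  by apply: (measurableT_comp mb); exact: measurable_subsample.
have Es (s : 'S_n) : iid_law P n [set D | b D] =
    (\int[iid_law P n]_D ((b (subsample s D))%:R : R)%:E)%E.
  rewrite -measure_event//; apply/esym.
  by apply: (@iid_law_subsample _ _ _ P _ _ s [set D | b D]);
    [exact: perm_inj|exact: measurable_event].
have : (\sum_(s : 'S_n) iid_law P n [set D | b D] <= (c * n`!%:R)%:E)%E.
  rewrite (eq_bigr _ (fun s _ => Es s)) -ge0_integral_sum//; last first.
    by move=> s; apply/measurable_EFinP; exact: measurable_natr.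
  apply: (@le_trans _ _ (\int[iid_law P n]_D (cst (c * n`!%:R)%:E D))%E);
    last first.
    rewrite integral_cst// -[leRHS]mule1 lee_pmul//; last first.
      exact: probability_le1.
    by rewrite lee_fin (le_trans _ (bc (nseq_tuple n point))).
  apply: ge0_le_integral => //.
  - by move=> D _; apply: sume_ge0 => s _; rewrite lee_fin.
  - by apply: emeasurable_sum => s; apply/measurable_EFinP;
      exact: measurable_natr.
  - move=> D _; rewrite sumEFin lee_fin; apply: le_trans (bc D).
    rewrite -natr_sum -sum1_card ler_nat [leqRHS]big_mkcond/=.
    by apply: leq_sum => s _; rewrite inE; case: (b _).
have : iid_law P n [set D | b D] \is a fin_num.
  by apply: fin_num_measure; exact: measurable_event.
move: (iid_law P n _) => [r _| |]//; rewrite sumEFin sumr_const card_Sn.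
rewrite !lee_fin => h; rewrite -(ler_pM2r (_ : 0 < n`!%:R)) ?ltr0n ?fact_gt0//.
by rewrite mulr_natr.
Qed.

End exchangeability.

Section independent_draws.
Context d (T : measurableType d) (R : realType) (P : probability T R).

(** Independence of the coordinates: the integral over the sample factors, one
    point at a time, by the Fubini-Tonelli theorem. *)
Lemma integral_iid_prod (w : T -> R) (r : R) m :
  measurable_fun setT w -> (forall z, 0 <= w z) -> 
  (\int[P]_z (w z)%:E = r%:E)%E ->
  (\int[iid_law P m]_D (\prod_(j < m) w (tnth D j))%:E = (r ^+ m)%:E)%E.
Proof.
move=> mw w0 wr.
have mprod k : measurable_fun setT
    (fun D : k.-tuple T => (\prod_(j < k) w (tnth D j))%:E).
  apply/measurable_EFinP; apply: measurable_prod => j _.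
  by apply: (measurableT_comp mw); exact: measurable_tnth.
have prod0 k (D : k.-tuple T) : (0 <= (\prod_(j < k) w (tnth D j))%:E)%E.
  by rewrite lee_fin prodr_ge0.
elim: m => [|m IH].
  under eq_integral do rewrite big_ord0.
  rewrite integral_cst// expr0 -[RHS]mule1; congr (_ * _)%E.
  exact: probability_setT.
rewrite ge0_integral_cons//.
transitivity (\int[P]_z ((r ^+ m)%:E * (w z)%:E))%E.
  apply: eq_integral => z _.
  transitivity (\int[iid_law P m]_D
    ((w z)%:E * (\prod_(j < m) w (tnth D j))%:E))%E.
    apply: eq_integral => D _; rewrite -EFinM big_ord_recl tnth0;
      congr (_ * _)%:E.
    by apply: eq_bigr => j _; rewrite tnthS.
  by rewrite [RHS]muleC ge0_integralZl_EFin//;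
    [congr (_ * _)%E; exact: IH|exact: mprod].
rewrite ge0_integralZl_EFin ?wr -?EFinM ?exprSr//.
- by move=> z _; rewrite lee_fin.
- exact/measurable_EFinP.
- by rewrite exprn_ge0// -lee_fin -wr integral_ge0// => z _; rewrite lee_fin.
Qed.

(** Chernoff's method with the bound of [bernoulli_mgf_le] on each factor. *)
Lemma hoeffding_iid (M : T -> bool) m (q t : R) :
  measurable_fun setT M -> (P [set z | M z] <= q%:E)%E -> 0 <= t ->
  (iid_law P m [set D | (m%:R * (q + t) <= \sum_(j < m) (M (tnth D j))%:R)%R]
   <= (expR (- (2 * m%:R * t ^+ 2)))%:E)%E.
Proof.
move=> mM Mq t0.
have mE : measurable [set z | M z] by exact: measurable_event.
have [p0 p1] : (0 <= P [set z | M z])%E /\ (P [set z | M z] <= 1)%E.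
  by split; [exact: measure_ge0|exact: probability_le1].
move EP : (P [set z | M z]) p0 p1 Mq => [p| |]//; rewrite !lee_fin => p0 p1 pq.
(* The exponent that minimizes the Chernoff bound. *)
pose x := 4 * t.
have x0 : 0 <= x by rewrite mulr_ge0.
pose w z := expR (x * (M z)%:R).
have mw : measurable_fun setT w.
  apply: measurableT_comp => //; apply: measurable_funM => //.
  exact: measurable_natr.
have wp : (\int[P]_z (w z)%:E = (1 - p + p * expR x)%:E)%E.
  rewrite (eq_integral (fun z => (1 + (expR x - 1)%:E * (M z)%:R%:E))%E);
    last first.
    move=> z _; rewrite /w -EFinM -EFinD; congr _%:E.
    by case: (M z); rewrite ?mulr1 ?mulr0 ?expR0; ring.
  have ex1 : 0 <= expR x - 1 by rewrite subr_ge0 -expR0 ler_expR.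
  have mMr : measurable_fun setT (fun z => ((M z)%:R : R)%:E).
    by apply/measurable_EFinP; exact: measurable_natr.
  rewrite ge0_integralD//; last 2 first.
  - by move=> z _; rewrite -EFinM lee_fin mulr_ge0.
  - exact: measurable_funeM.
  rewrite ge0_integralZl_EFin//.
  rewrite (_ : \int[P]_z ((M z)%:R)%:E = p%:E)%E; last first.
    by rewrite -EP; apply/esym; exact: measure_event.
  have -> : (\int[P]_z 1 = 1)%E.
    by rewrite integral_cst// -[RHS]mule1; congr (_ * _)%E;
      exact: probability_setT.
  by rewrite -EFinM -EFinD; congr _%:E; ring.
pose K := expR (x * (m%:R * (q + t))).
have K0 : (0 < K%:E)%E by rewrite lte_fin expR_gt0.
rewrite -(lee_pmul2l (erefl : K%:E \is a fin_num) K0).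
apply: (le_trans (@markov_event _ _ _ (iid_law P m) _
    (fun D => (\prod_(j < m) w (tnth D j))%:E) _ _ _ _ _ _)).
- apply: measurable_fun_ler => //.
  apply: measurable_sum => j; apply: measurable_natr.
  by apply: (measurableT_comp mM); exact: measurable_tnth.
- apply/measurable_EFinP; apply: measurable_prod => j _.
  by apply: (measurableT_comp mw); exact: measurable_tnth.
- by move=> D; rewrite lee_fin prodr_ge0// => j _; exact: expR_ge0.
- exact: expR_ge0.
- by move=> D h; rewrite lee_fin -expR_sum -mulr_sumr ler_expR ler_wpM2l.
rewrite (integral_iid_prod m mw (fun z => expR_ge0 _) wp).
rewrite -EFinM lee_fin -expRD.
apply: (@le_trans _ _ (expR (x * p + x ^+ 2 / 8) ^+ m)).
  apply: lerXn2r; rewrite ?nnegrE ?expR_ge0 ?bernoulli_mgf_le ?p0 ?p1//.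
  by rewrite addr_ge0 ?subr_ge0// mulr_ge0// expR_ge0.
rewrite -expRM_natl ler_expR.
rewrite [leRHS](_ : _ = m%:R * (x * q + x ^+ 2 / 8)).
  by rewrite ler_wpM2l// lerD2r ler_wpM2l.
by rewrite /x; field.
Qed.

End independent_draws.

(** * Quantiles as counts *)

Section quantile_counts.
Context {R : realType}.

Lemma natr_card (I : finType) (p : pred I) :
  #|p|%:R = \sum_i (p i)%:R :> R.
Proof.
rewrite -sum1_card natr_sum big_mkcond/=; apply: eq_bigr => i _.
by rewrite unfold_in; case: (p i).
Qed.

(** This turns a comparison with a quantile into a count, which makes sense of
    infinite quantiles and is visibly measurable. *)
Lemma le_quantile n (v : 'I_n -> R) (tau y : R) : (0 < n)%N -> 0 < tau ->
  (y%:E <= quantile v tau)%E = (\sum_i (v i < y)%R%:R < tau * n%:R).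
Proof.
move=> n0 tau0; rewrite /quantile; case: ifPn => [tau1|_].
  rewrite leey; apply/esym; apply: (@le_lt_trans _ _ n%:R).
    rewrite -natr_card ler_nat; apply: leq_trans (max_card _) _.
    by rewrite card_ord.
  by rewrite ltr_pMl// ltr0n.
apply/idP/idP => [yq|vy].
  rewrite ltNge; apply/negP => cv.
  have [i0 vi0] : exists i, v i < y.
    apply/existsP; apply: contraLR cv => /existsPn nv.
    rewrite -ltNge big1 ?mulr_gt0 ?ltr0n// => i _.
    by rewrite (negbTE (nv i)).
  case: (@Order.TotalTheory.arg_maxP _ _ _ i0 (fun i => v i < y) v vi0) => /= i
    vi imax.
  suff : (y%:E <= (v i)%:E)%E by rewrite lee_fin leNgt vi.
  apply: (le_trans yq); apply: ereal_inf_lbound; exists (v i) => //=.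
  rewrite natr_card (le_trans cv)//; apply: ler_sum => j _.
  by case: (boolP (v j < y)) => // /imax; rewrite /= => ->.
apply: le_ereal_inf_tmp => _ [t /= ct <-]; rewrite lee_fin leNgt;
  apply/negP => ty.
move: vy; rewrite ltNge => /negP; apply; apply: (le_trans ct).
rewrite natr_card; apply: ler_sum => j _ /=.
by case: (boolP (v j <= t)) => // /le_lt_trans/(_ ty) ->.
Qed.

(** The points [y] described are those with [q < y <= q + eps], for [q] the
    quantile of [v] at level [c / n]; there are none if [q] is infinite. *)
Lemma count_crossing_itv n (v : 'I_n -> R) (c eps : R) : (0 < n)%N -> 0 < c ->
  exists a, forall y, c <= \sum_i (v i < y)%R%:R ->
    \sum_i (v i + eps < y)%R%:R < c -> a <= y <= a + eps.
Proof.
move=> n0 c0; have nn0 : n%:R != 0 :> R by rewrite pnatr_eq0 -lt0n.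
pose q := quantile v (c / n%:R).
have qE y : (y%:E <= q)%E = (\sum_i (v i < y)%R%:R < c).
  by rewrite le_quantile// ?divr_gt0 ?ltr0n// divfK.
exists (fine q) => y cy cye.
have yq : (q < y%:E)%E by rewrite ltNge qE -leNgt.
have qy : ((y - eps)%:E <= q)%E.
  rewrite qE; apply: le_lt_trans cye; apply: ler_sum => i _.
  by rewrite ltrBrDr.
move: yq qy; case: q {qE} => [q| |]//=; rewrite lte_fin lee_fin => qy yq.
by rewrite ltW//= -lerBlDr.
Qed.

End quantile_counts.

(** * Disintegration and bounded densities *)

Section disintegration.
Context d (X : measurableType d) (R : realType) (P : probability (X * R)%type R)
  (kappa : R.-pker X ~> R).
Local Open Scope ereal_scope.

(** The joint law rebuilt from the marginal of [X] and the kernel. *)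
Definition glue (Q : set (X * R)) : \bar R :=
  \int[marginalX P]_x kappa x (xsection Q x).

Let glue0 : glue set0 = 0.
Proof. by rewrite /glue integral0_eq// => x _; rewrite xsection0 measure0. Qed.

Let glue_ge0 Q : 0 <= glue Q.
Proof. by apply: integral_ge0 => x _; exact: measure_ge0. Qed.

Let glue_sigma_additive : semi_sigma_additive glue.
Proof.
move=> F mF tF mUF.
rewrite [X in _ --> X](_ : _ = \sum_(n <oo) glue (F n)).
  apply/cvg_closeP; split; last by rewrite closeE.
  by apply: is_cvg_nneseries => *; exact: integral_ge0.
rewrite -integral_nneseries//; last first.
  by move=> n; apply: measurable_fun_xsection_finite_kernel; rewrite inE.
apply: eq_integral => x _; apply/esym/cvg_lim => //=; rewrite xsection_bigcup.
apply: (measure_sigma_additive _ (trivIset_xsection tF)) => n.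
exact: measurable_xsection.
Qed.

HB.instance Definition _ := isMeasure.Build _ _ _ glue
  glue0 glue_ge0 glue_sigma_additive.

Lemma conditional_distribution_xsection (Q : set (X * R)) :
  conditional_distribution P kappa -> measurable Q ->
  P Q = \int[marginalX P]_x kappa x (xsection Q x).
Proof.
move=> Pk mQ; rewrite -/(glue Q).
pose C : set (set (X * R)) :=
  [set A `*` B | A in measurable & B in measurable].
apply: (measure_unique C (fun=> setT)) => //.
- by rewrite measurable_prod_measurableType.
- move=> _ _ [A1 mA1 [B1 mB1 <-]] [A2 mA2 [B2 mB2 <-]]; rewrite -setXI.
  exists (A1 `&` A2); first exact: measurableI.
  by exists (B1 `&` B2) => //; exact: measurableI.
- move=> _; exists setT => //; exists setT => //; exact: setXTT.
- by rewrite bigcup_const//; exists 0%N.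
- move=> _ [A mA [B mB <-]]; rewrite /= Pk// /glue integral_mkcond.
  apply: eq_integral => x _; rewrite patchE.
  case: ifPn => xA; first by rewrite in_xsectionX.
  by rewrite notin_xsectionX// measure0.
- by move=> _; rewrite (le_lt_trans (probability_le1 _ _)) ?ltry.
Qed.

End disintegration.

Section bounded_density.
Context d (X : measurableType d) (R : realType) (P : probability (X * R)%type R)
  (f : X -> R -> R).
Hypothesis densf : conditional_density P f.
Hypothesis meas_sup : measurable_fun setT (sup_density f).
Local Open Scope ereal_scope.

Lemma sup_density_ge0 x : 0 <= sup_density f x.
Proof.
have [f0 _ _] := densf; apply: (@le_trans _ _ (f x 0%R)%:E).
  by rewrite lee_fin.
by apply: ereal_sup_ubound; exists 0%R.
Qed.

Lemma B_dens_ge0 : 0 <= B_dens P f.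
Proof. by apply: integral_ge0 => x _; exact: sup_density_ge0. Qed.

(** Given [x], the section has a conditional probability of at most [sup_density
    f x * L], to be integrated over [x]. The length [L] may be infinite: this is
    how [B_dens_gt0] uses the bound. *)
Lemma prob_le_B_dens (Q : set (X * R)) (L : \bar R) : measurable Q -> 0 <= L ->
  (forall x, lebesgue_measure (xsection Q x) <= L) -> P Q <= B_dens P f * L.
Proof.
move=> mQ L0 QL; have [f0 mf [kappa Pk kf]] := densf.
rewrite (conditional_distribution_xsection Pk mQ).
rewrite -ge0_integralZr//; last by move=> x _; exact: sup_density_ge0.
apply: ae_ge0_le_integral => //.
- by apply: measurable_fun_xsection_finite_kernel; rewrite inE.
- by move=> x _; rewrite mule_ge0// sup_density_ge0.
- by apply: emeasurable_funM => //.
apply: filterS kf => x kf _; have mQx := measurable_xsection x mQ.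
rewrite kf//; apply: (@le_trans _ _ (sup_density f x *
    lebesgue_measure (xsection Q x))); last first.
  by rewrite lee_wpmul2l// sup_density_ge0.
rewrite -integral_cst//; apply: ge0_le_integral => //.
- by move=> y _; rewrite lee_fin.
- by apply/measurable_EFinP; apply: measurable_funS (mf x).
- by move=> y _; apply: ereal_sup_ubound; exists y.
Qed.

(** With [B_dens P f = 0], the bound [prob_le_B_dens] on the whole space would
    give it probability [0 * +oo = 0]. *)
Lemma B_dens_gt0 : 0 < B_dens P f.
Proof.
rewrite lt_neqAle B_dens_ge0 andbT; apply/eqP => B0.
have := prob_le_B_dens (L := +oo) measurableT (leey _) (fun=> leey _).
rewrite -B0 mul0e; apply/negP; rewrite -ltNge.
by rewrite probability_setT lte01.
Qed.

Lemma prob_strip_le (Q : set (X * R)) (eps : R) : measurable Q -> (0 <= eps)%R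
  ->
  (forall x, exists a, forall y, Q (x, y) -> (a <= y <= a + eps)%R) ->
  P Q <= eps%:E * B_dens P f.
Proof.
move=> mQ eps0 Qitv; rewrite muleC; apply: prob_le_B_dens; rewrite ?lee_fin//.
move=> x; have [a Qa] := Qitv x.
have QI : xsection Q x `<=` `[a, (a + eps)%R]%classic.
  by move=> y; rewrite /xsection/= inE in_itv/= => /Qa.
have := le_measure (@lebesgue_measure R) _ _ QI.
rewrite !inE => /(_ (measurable_xsection x mQ) (measurable_itv _)) le1.
suff le2 : lebesgue_measure `[a, (a + eps)%R]%classic <= eps%:E.
  exact: (le_trans le1 le2).
rewrite lebesgue_measure_itv/= lte_fin; case: ifP => _; rewrite ?lee_fin//.
by rewrite addrAC subrr add0r.
Qed.

End bounded_density.

(** * Fits on parts of a sample *)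

Section fits.
Context d (X : measurableType d) (R : realType) (A : regression_algorithm X R).
Hypothesis symA : symmetric_algorithm A.
Hypothesis measA : jointly_measurable A.

Definition fit N (D : N.-tuple (X * R)) (S : {set 'I_N}) : {mfun X >-> R} :=
  A [seq tnth D k | k <- enum S].

(** Two enumerations of [S] differ by a permutation, to which a symmetric
    algorithm is blind. *)
Lemma fit_seq N (D : N.-tuple (X * R)) (l : seq 'I_N) (S : {set 'I_N}) :
  uniq l -> l =i S -> A [seq tnth D k | k <- l] = fit D S.
Proof.
move=> ul lS.
have /tuple_permP[s ls] : perm_eq l (in_tuple (enum S)).
  by apply: uniq_perm => //; [exact: enum_uniq|move=> k; rewrite lS mem_enum].
pose t := [tuple tnth D (tnth (in_tuple (enum S)) i) | i < size (enum S)].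
have -> : [seq tnth D k | k <- l] = [tuple tnth t (s i) | i < size (enum S)].
  rewrite ls -map_comp /=; apply: eq_map => i /=.
  by rewrite tnth_mktuple.
rewrite -symA; congr (A _);
  rewrite -[in RHS](map_tnth_enum (in_tuple (enum S))).
by rewrite -map_comp.
Qed.

Lemma fit_subsample N M (s : 'I_M -> 'I_N) (D : N.-tuple (X * R))
    (S : {set 'I_M}) : injective s ->
  fit (subsample s D) S = fit D [set s i | i in S].
Proof.
move=> sI; rewrite -(fit_seq D (l:=[seq s i | i <- enum S])).
- rewrite /fit -map_comp; congr (A _); apply: eq_map => i /=.
  by rewrite tnth_mktuple.
- by rewrite map_inj_uniq ?enum_uniq.
move=> k; apply/mapP/imsetP => -[i iS ->]; exists i => //.
  by rewrite mem_enum in iS.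
by rewrite mem_enum.
Qed.

Lemma leave_one_out_fit n (D : n.-tuple (X * R)) i :
  leave_one_out A D i = fit D (~: [set i]).
Proof.
apply: fit_seq; first by rewrite filter_uniq ?enum_uniq.
by move=> k; rewrite mem_filter mem_enum andbT !inE.
Qed.

Lemma measurable_fit N (S : {set 'I_N}) :
  measurable_fun setT (fun p : N.-tuple (X * R) * X => fit p.1 S p.2 : R).
Proof.
pose s (i : 'I_#|S|) : 'I_N := enum_val i.
have -> : (fun p : N.-tuple (X * R) * X => fit p.1 S p.2 : R) =
    (fun p : #|S|.-tuple (X * R) * X => A p.1 p.2 : R) \o
    (fun p => (subsample s p.1, p.2)).
  apply/funext => -[D x] /=;
    rewrite -(fit_seq D (l:=[seq s i | i <- enum 'I_#|S|])).
  - by rewrite -map_comp.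
  - by rewrite map_inj_uniq ?enum_uniq//; exact: enum_val_inj.
  move=> k; apply/mapP/idP => [[i _ ->]|kS]; first exact: enum_valP.
  by exists (enum_rank_in kS k); rewrite ?mem_enum// /s enum_rankK_in.
apply: measurableT_comp; first exact: measA.
apply: measurable_fun_pair => //.
exact: (measurableT_comp (measurable_subsample _) measurable_fst).
Qed.

Lemma measurable_fit_comp d' (T : measurableType d') N (S : {set 'I_N})
    (D : T -> N.-tuple (X * R)) (x : T -> X) :
  measurable_fun setT D -> measurable_fun setT x ->
  measurable_fun setT (fun t => fit (D t) S (x t) : R).
Proof.
move=> mD mx; apply: (measurableT_comp (measurable_fit S)
  (measurable_fun_pair mD mx)).
Qed.

Definition residual N (D : N.-tuple (X * R)) (k : 'I_N) : R :=
  `|(tnth D k).2 - fit D (~: [set k]) (tnth D k).1|.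

Lemma residual_subsample N (s : 'S_N) (D : N.-tuple (X * R)) k :
  residual (subsample s D) k = residual D (s k).
Proof.
rewrite /residual tnth_mktuple fit_subsample; last exact: perm_inj.
congr (`|_ - fit D _ _|); apply/setP => j; rewrite !inE.
apply/imsetP/idP => [[i + ->]|jk].
  by rewrite !inE; apply: contraNneq => /perm_inj ->.
exists (s^-1%g j); rewrite ?permKV// !inE.
by apply: contraNneq jk => <-; rewrite permKV.
Qed.

Lemma loo_residual_fit n (D : n.-tuple (X * R)) i :
  loo_residual A D i = residual D i.
Proof. by rewrite /loo_residual leave_one_out_fit. Qed.

Lemma measurable_residual N k :
  measurable_fun setT (fun D : N.-tuple (X * R) => residual D k).
Proof.
have mk := measurable_tnth (T := (X * R)%type) k.
apply: measurableT_comp => //; apply: measurable_funB.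
  exact: (measurableT_comp measurable_snd mk).
apply: measurable_fit_comp => //.
exact: (measurableT_comp measurable_fst mk).
Qed.

Definition instability N (D : N.-tuple (X * R)) (S : {set 'I_N}) (j : 'I_N) : R
  :=
  `|fit D S (tnth D j).1 - fit D (~: [set j]) (tnth D j).1|.

Lemma instability_ge0 N (D : N.-tuple (X * R)) S j : 0 <= instability D S j.
Proof. exact: normr_ge0. Qed.

Lemma measurable_instability N S j :
  measurable_fun setT (fun D : N.-tuple (X * R) => instability D S j).
Proof.
have mj := measurable_tnth (T := (X * R)%type) j.
apply: measurableT_comp => //; apply: measurable_funB;
  apply: measurable_fit_comp => //; exact: (measurableT_comp measurable_fst mj).
Qed.

(** The index [j] followed by those of [S] and then by the remaining ones is a
    reordering of the sample: its head plays the test point, its next [k]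
    entries the smaller training set, and all the entries after the head the
    larger one. *)
Lemma integral_instability (P : probability (X * R)%type R) k m
    (S : {set 'I_(k + m).+1}) (j : 'I_(k + m).+1) :
  #|S| = k -> j \notin S ->
  (\int[iid_law P (k + m).+1]_D (instability D S j)%:E = beta_out P A m k)%E.
Proof.
move=> Sk jS; set N := (k + m).+1 in S j Sk jS *.
pose l := j :: enum S ++ enum (~: (j |: S)).
have ul : uniq l.
  rewrite /= cat_uniq !enum_uniq /= andbT mem_cat !mem_enum !inE eqxx
    (negbTE jS)/=.
  by apply/hasPn => i; rewrite !mem_enum !inE negb_or => /andP[].
have sl : size l = N.
  rewrite -(card_uniqP ul) -[RHS]card_ord; apply: eq_card => i.
  by rewrite !inE mem_cat !mem_enum !inE; case: (i == j); case: (i \in S).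
pose s (i : 'I_N) : 'I_N := nth j l i.
have sI : injective s.
  move=> i1 i2 /eqP; rewrite nth_uniq ?sl ?ltn_ord// => /eqP; exact: val_inj.
have lE : l = [seq s i | i <- enum 'I_N].
  apply: (@eq_from_nth _ j); first by rewrite size_map size_enum_ord.
  move=> i; rewrite sl => iN; rewrite (nth_map ord0) ?size_enum_ord//.
  by rewrite /s nth_enum_ord.
pose h (E : (k + m).-tuple (X * R)) (z : X * R) : R := `|A (take k E) z.1 - A E
  z.1|.
have mh : measurable_fun setT
  (fun p : (k + m).-tuple (X * R) * (X * R) => h p.1 p.2).
  have mx : measurable_fun setT
    (fun p : (k + m).-tuple (X * R) * (X * R) => p.2.1).
    exact: (measurableT_comp measurable_fst measurable_snd).
  apply: measurableT_comp => //; apply: measurable_funB.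
    rewrite (_ : (fun _ => _) = (fun p : (k + m).-tuple (X * R) * (X * R) =>
        A (subsample (lshift m) p.1) p.2.1)).
      have ms := measurableT_comp
        (measurable_subsample (T := (X * R)%type) (@lshift k m))
        (@measurable_fst _ _ _ (X * R)%type).
      exact: (measurableT_comp (@measA k) (measurable_fun_pair ms mx)).
    by apply/funext => -[E z] /=; rewrite take_subsample.
  exact: (measurableT_comp (@measA (k + m))
    (measurable_fun_pair measurable_fst mx)).
pose H (D : N.-tuple (X * R)) : \bar R :=
  (h (subsample (lift ord0) D) (tnth D ord0))%:E.
have mH : measurable_fun setT H.
  apply/measurable_EFinP.
  apply: (measurableT_comp mh (measurable_fun_pair _ (measurable_tnth ord0))).
  exact: measurable_subsample.
transitivity (\int[iid_law P N]_D H (subsample s D))%E.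
  apply: eq_integral => D _; congr (_%:E).
  have sD : subsample (lift ord0) (subsample s D) =
      [seq tnth D i | i <- enum S ++ enum (~: (j |: S))] :> seq _.
    rewrite (_ : enum S ++ _ = behead l)// lE enum_ordSl /= -!map_comp.
    by apply: eq_map => i /=; rewrite !tnth_mktuple.
  rewrite /h sD tnth_mktuple map_cat take_size_cat ?size_map -?cardE//.
  rewrite -map_cat (@fit_seq _ D (enum S ++ _) (~: [set j]))//.
    by move: ul => /= /andP[].
  move=> i; rewrite mem_cat !mem_enum !inE.
  have [->|_] := eqVneq i j; first by rewrite (negbTE jS).
  by case: (i \in S).
have H0 D : (0 <= H D)%E by rewrite /H /h lee_fin.
rewrite (ge0_integral_subsample P sI mH H0).
rewrite ge0_integral_cons//.
rewrite /beta_out fubini_tonelli2//; last by apply/measurable_EFinP.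
apply: eq_integral => z _; apply: eq_integral => E _; rewrite /H.
have -> : subsample (lift ord0) (tuple_cons (z, E)) = E.
  by apply: eq_from_tnth => i; rewrite tnth_mktuple; exact: tnthS.
by rewrite (_ : tnth _ _ = z).
Qed.

End fits.

(** * The miscoverage event and the cost of inflating the interval *)

Section miss_event.
Context d (X : measurableType d) (R : realType) (A : regression_algorithm X R)
  (alpha : R).
Hypothesis symA : symmetric_algorithm A.
Hypothesis measA : jointly_measurable A.
Hypothesis alpha1 : alpha < 1.

(** This is [(1 - alpha) * (n + 1)]: a point is above the interval when it
    exceeds at least that many of the upper endpoints [fit + residual]. *)
Definition level n : R := (1 - alpha) * (1 + n%:R^-1) * n%:R.

Definition above eps n (D : n.-tuple (X * R)) (z : X * R) : bool :=
  level n <= \sum_(i < n)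
    (fit A D (~: [set i]) z.1 + residual A D i + eps < z.2)%R%:R.

Definition below eps n (D : n.-tuple (X * R)) (z : X * R) : bool :=
  level n <= \sum_(i < n)
    (- fit A D (~: [set i]) z.1 + residual A D i + eps < - z.2)%R%:R.

(** The interval is enlarged by [eps] on each side; [eps = 0] gives the
    jackknife+ interval. *)
Definition miss eps n (D : n.-tuple (X * R)) (z : X * R) : bool :=
  above eps D z || below eps D z.

Lemma level_gt0 n : (0 < n)%N -> 0 < level n.
Proof.
move=> n0; rewrite /level !mulr_gt0 ?ltr0n// ?subr_gt0//.
Qed.

Lemma level_ge n : (0 < n)%N -> (1 - alpha) * n%:R <= level n.
Proof.
move=> n0; rewrite /level ler_pM2r ?ltr0n// ler_peMr ?subr_ge0 ?(ltW alpha1)//.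
by rewrite lerDl invr_ge0.
Qed.

Lemma jackknife_plus_miss n (D : n.-tuple (X * R)) z : (0 < n)%N ->
  (~ jackknife_plus A alpha D z.1 z.2) <-> miss 0 D z.
Proof.
move=> n0; have tau0 : 0 < (1 - alpha) * (1 + n%:R^-1) :> R.
  by rewrite mulr_gt0 ?subr_gt0// ltr_pwDl// invr_ge0.
rewrite /jackknife_plus /= leeNl -EFinN !le_quantile//.
rewrite /miss /above /below -/(level n).
have E1 : \sum_(i < n) (leave_one_out A D i z.1 + loo_residual A D i <
  z.2)%R%:R =
  \sum_(i < n) (fit A D (~: [set i]) z.1 + residual A D i + 0 < z.2)%R%:R :> R.
  by apply: eq_bigr => i _; rewrite leave_one_out_fit// loo_residual_fit//
    addr0.
have E2 : \sum_(i < n) (- leave_one_out A D i z.1 + loo_residual A D i < -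
  z.2)%R%:R =
  \sum_(i < n) (- fit A D (~: [set i]) z.1 + residual A D i + 0 < - z.2)%R%:R
    :> R.
  by apply: eq_bigr => i _; rewrite leave_one_out_fit// loo_residual_fit//
    addr0.
rewrite E1 E2 !ltNge -negb_or orbC; split; first by move/negP; rewrite negbK.
by move=> h /negP.
Qed.

Lemma measurable_miss eps n d' (T : measurableType d')
    (D : T -> n.-tuple (X * R)) (z : T -> X * R) :
  measurable_fun setT D -> measurable_fun setT z ->
  [/\ measurable_fun setT (fun t => above eps (D t) (z t)),
    measurable_fun setT (fun t => below eps (D t) (z t)) &
    measurable_fun setT (fun t => miss eps (D t) (z t))].
Proof.
move=> mD mz.
have mz2 := measurableT_comp (@measurable_snd _ _ X R) mz.
have mz1 := measurableT_comp (@measurable_fst _ _ X R) mz.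
have mf i := measurable_fit_comp symA measA (~: [set i])%SET mD mz1.
have mr i := measurableT_comp (measurable_residual symA measA i) mD.
have ma : measurable_fun setT (fun t => above eps (D t) (z t)).
  apply: measurable_fun_ler => //; apply: measurable_count => i.
  apply: measurable_fun_ltr => //; apply: measurable_funD => //.
  exact: (measurable_funD (mf i) (mr i)).
have mb : measurable_fun setT (fun t => below eps (D t) (z t)).
  apply: measurable_fun_ler => //; apply: measurable_count => i.
  apply: measurable_fun_ltr; last exact: (measurable_funN mz2).
  apply: measurable_funD => //.
  exact: (measurable_funD (measurable_funN (mf i)) (mr i)).
by split=> //; exact: measurable_or.
Qed.

Lemma miss_count eps n (D : n.-tuple (X * R)) z : miss eps D z ->
  level n <= \sum_(i < n)
    (residual A D i + eps < `|z.2 - fit A D (~: [set i]) z.1|)%R%:R.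
Proof.
case/orP => h; apply: (le_trans h); apply: ler_sum => i _;
  case: ltP => //= lt1; rewrite (_ : (_ < _) = true)//.
  by apply: lt_le_trans (ler_norm _); lra.
by rewrite distrC; apply: lt_le_trans (ler_norm _); lra.
Qed.

Section miss_probability.
Context (P : probability (X * R)%type R).

Lemma measurable_miss_prob eps n :
  measurable_fun setT (fun D : n.-tuple (X * R) => P [set z | miss eps D z]).
Proof.
pose Q : set (n.-tuple (X * R) * (X * R)) := [set p | miss eps p.1 p.2].
have mQ : measurable Q.
  apply: measurable_event.
  by have [] := measurable_miss eps
    (@measurable_fst _ _ (n.-tuple (X * R)) (X * R)%type) measurable_snd.
rewrite (_ : (fun D => _) = fun D => P (xsection Q D)).
  exact: measurable_fun_xsection.
apply/funext => D; congr (P _).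
by apply/seteqP; split=> z; rewrite /xsection/= inE.
Qed.

Lemma miscoverageE n (D : n.-tuple (X * R)) : (0 < n)%N ->
  miscoverage P A alpha D = P [set z | miss 0 D z].
Proof.
move=> n0; rewrite /miscoverage; congr (P _).
by apply/seteqP; split=> z /= /(jackknife_plus_miss D z n0).
Qed.

(** A point missed by the interval but not by its enlargement is within [eps] of
    one of the two endpoints, which for a given [x] confines [y] to two
    intervals of length [eps]. *)
Lemma miscoverage_le_inflated (f : X -> R -> R) eps n (D : n.-tuple (X * R)) :
  conditional_density P f -> measurable_fun setT (sup_density f) ->
  (0 < n)%N -> 0 <= eps ->
  (P [set z | miss 0 D z] <=
   P [set z | miss eps D z] + 2%:E * (eps%:E * B_dens P f))%E.
Proof.
move=> densf msup n0 eps0.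
have mid : measurable_fun setT (@id (X * R)) by exact: measurable_id.
have mm e := measurable_miss e (measurable_cst D) mid.
have c0 := level_gt0 n0.
pose Q1 : set (X * R) := [set z | above 0 D z && ~~ above eps D z].
pose Q2 : set (X * R) := [set z | below 0 D z && ~~ below eps D z].
have mQ1 : measurable Q1.
  apply: measurable_event; apply: measurable_and; first by case: (mm 0).
  by apply: measurable_neg; case: (mm eps).
have mQ2 : measurable Q2.
  apply: measurable_event; apply: measurable_and; first by case: (mm 0).
  by apply: measurable_neg; case: (mm eps).
have m0 : measurable [set z | miss 0 D z].
  by apply: measurable_event; case: (mm 0).
have me : measurable [set z | miss eps D z].
  by apply: measurable_event; case: (mm eps).
have PQ1 : (P Q1 <= eps%:E * B_dens P f)%E.
  apply: prob_strip_le => // x.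
  have [a ha] := count_crossing_itv (fun i => fit A D (~: [set i]) x +
    residual A D i) eps n0 c0.
  exists a => y /= /andP[h1]; rewrite /above -ltNge; apply: ha.
  by apply: (le_trans h1); apply: ler_sum => i _; rewrite addr0.
have PQ2 : (P Q2 <= eps%:E * B_dens P f)%E.
  apply: prob_strip_le => // x.
  have [a ha] := count_crossing_itv (fun i => - fit A D (~: [set i]) x +
    residual A D i) eps n0 c0.
  exists (- a - eps) => y /= /andP[h1]; rewrite /below -ltNge => h2.
  suff : a <= - y <= a + eps by lra.
  apply: ha h2.
  by apply: (le_trans h1); apply: ler_sum => i _; rewrite addr0.
apply: (@le_trans _ _ (P ([set z | miss eps D z] `|` (Q1 `|` Q2)))).
  apply: le_measure; rewrite ?inE//.
    by apply: measurableU => //; exact: measurableU.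
  move=> z /=; rewrite /Q1 /Q2 /miss /=.
  case: (above eps D z) => /=; first by left.
  case: (below eps D z) => /=; first by left.
  by case/orP => ->; right; [left|right].
apply: (le_trans (measureU2 _ _ _)) => //; first exact: measurableU.
rewrite leeD2l//; apply: (le_trans (measureU2 _ _ _)) => //.
rewrite (_ : (2%:E * _ = eps%:E * B_dens P f + eps%:E * B_dens P f)%E) ?leeD//.
by rewrite mule_natl mule2n.
Qed.

End miss_probability.

End miss_event.

(** * The largest residuals *)

Section ranks.
Context {R : realType} {N : nat}.
Implicit Types (r : 'I_N -> R) (p : R).

Definition rank r k : R := \sum_l (r l < r k)%R%:R.

(** The largest values. Ranks count strictly smaller values, so that ties cannot
    make this set larger than a fraction [p] of the indices. *)
Definition upper p r : {set 'I_N} := [set k | (1 - p) * N%:R <= rank r k]%SET.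

Definition lower p r : {set 'I_N} :=
  [set l | [exists j, (j \notin upper p r) && (r l < r j)]]%SET.

Lemma rankE r k : rank r k = #|[set l | r l < r k]%SET|%:R.
Proof.
rewrite /rank -(natr_card (fun l => r l < r k)); congr _%:R.
by apply: eq_card => l; rewrite inE.
Qed.

(** All the values at [upper p r] are at least the smallest one of them, and at
    least a fraction [1 - p] of the values are below that one. *)
Lemma card_upper p r : 0 <= p -> #|upper p r|%:R <= p * N%:R.
Proof.
move=> p0; case: (set_0Vmem (upper p r)) => [->|[k0 k0U]].
  by rewrite cards0 mulr_ge0.
have [k kU kmin] := @Order.TotalTheory.arg_minP _ _ _ k0
  (fun k => k \in upper p r) r k0U.
have kr : (1 - p) * N%:R <= rank r k by move: kU; rewrite /= inE.
have /subset_leq_card le1 : upper p r \subset ~: [set l | r l < r k]%SET.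
  apply/fintype.subsetP => l lU; rewrite !inE -leNgt; exact: kmin.
move: le1; rewrite [leqRHS]cardsCs finset.setCK card_ord -(ler_nat R) =>
  /le_trans; apply.
rewrite natrB; last by rewrite -[leqRHS]card_ord max_card.
by rewrite -rankE; lra.
Qed.

(** The union of the sets of indices below those [j \notin upper p r] is the set
    below the largest such [j], whose rank is less than [(1 - p) * N]. The
    maximum with [0] covers the case where there is no such [j] and [p > 1]. *)
Lemma card_lower p r : #|lower p r|%:R <= Num.max 0 (1 - p) * N%:R.
Proof.
case: (set_0Vmem (~: upper p r)) => [U0|[k0 k0U]].
  have -> : lower p r = finset.set0.
    apply/setP => l; rewrite !inE; apply/existsP => -[j /andP[jU _]].
    by move: jU; rewrite -finset.in_setC U0 inE.
  by rewrite cards0 mulr_ge0// le_max lexx.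
have [k kU kmax] := @Order.TotalTheory.arg_maxP _ _ _ k0
  (fun k => k \in ~: upper p r) r k0U.
have kr : rank r k < (1 - p) * N%:R.
  by move: kU; rewrite /= !inE -ltNge.
have /subset_leq_card le1 : lower p r \subset [set l | r l < r k]%SET.
  apply/fintype.subsetP => l; rewrite !inE => /existsP[j /andP[jU lj]].
  by apply: lt_le_trans lj _; apply: kmax; rewrite inE.
move: le1; rewrite -(ler_nat R) -rankE => /le_trans; apply.
apply: (le_trans (ltW kr)).
by rewrite ler_wpM2r// le_max lexx orbT.
Qed.

Lemma rank_perm r (s : 'S_N) k : rank (fun i => r (s i)) k = rank r (s k).
Proof.
by rewrite /rank [RHS](reindex_inj (@perm_inj _ s)).
Qed.

Lemma upper_perm p r (s : 'S_N) k :
  (k \in upper p (fun i => r (s i))) = (s k \in upper p r).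
Proof. by rewrite !inE rank_perm. Qed.

Lemma lower_perm p r (s : 'S_N) k :
  (k \in lower p (fun i => r (s i))) = (s k \in lower p r).
Proof.
rewrite !inE; apply/existsP/existsP => -[j /andP[jU kj]].
  by exists (s j); rewrite -upper_perm jU.
by exists (s^-1%g j); rewrite upper_perm permKV jU.
Qed.

End ranks.

(** A test index [j] that is missed and has at most [s * n] bad training
    partners has at least [(1 - alpha - s) * n] training indices below it.
    Outside of [upper p r] these would all lie in [lower p r], and there are too
    few of those, so [j] is in [upper p r]. *)
Lemma count_miss_lt (R : realType) (n m : nat) (r : 'I_(n + m) -> R)
  (alpha s t v : R) (cmp bad : 'I_n -> 'I_m -> bool) (mis : 'I_m -> bool) :
  (0 < n)%N ->
  let p := alpha + s + t in
  (forall j, mis j -> (1 - alpha) * n%:R <= \sum_i (cmp i j)%:R) ->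
  (forall i j, cmp i j -> ~~ bad i j -> r (lshift m i) < r (rshift n j)) ->
  \sum_j (rshift n j \in upper p r)%:R < m%:R * (p + t) ->
  \sum_i (lshift m i \in lower p r)%:R < n%:R * (Num.max 0 (1 - p) + t) ->
  \sum_j (s * n%:R < \sum_i (bad i j)%:R)%R%:R <= v * m%:R ->
  \sum_j (mis j)%:R < m%:R * (p + t + v).
Proof.
move=> n0 p misP cmpP cU cV cB.
rewrite mulrDr [m%:R * v]mulrC; apply: le_lt_trans (ltr_leD cU cB).
rewrite -big_split/=; apply: ler_sum => j _.
case: (boolP (mis j)) => [/misP mj|_]; last by rewrite addr_ge0.
case: ltP => [_|good]; first by rewrite lerDr.
case: (boolP (_ \in _)) => [_|jU]; first by rewrite lerDl.
exfalso; have pj : 0 < 1 - p.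
  move: jU; rewrite inE -ltNge => /(le_lt_trans _) lt0.
  have := lt0 _ (sumr_ge0 _ (fun i _ => ler0n _ _)).
  by rewrite pmulr_lgt0// ltr0n addn_gt0 n0.
move: cV; rewrite ltNge => /negP; apply.
rewrite (max_idPr (ltW pj)).
have : \sum_i (cmp i j)%:R <= \sum_i (bad i j)%:R +
    \sum_i (lshift m i \in lower p r)%:R :> R.
  rewrite -big_split/=; apply: ler_sum => i _.
  case: (boolP (cmp i j)) => [cij|_]; last by rewrite addr_ge0.
  case: (boolP (bad i j)) => [_|nb]; first by rewrite lerDl.
  rewrite add0r (_ : (_ \in _) = true)//; rewrite inE; apply/existsP.
  by exists (rshift n j); rewrite jU cmpP.
rewrite /p; nra.
Qed.

Section exchangeable_sets.
Context d (T : measurableType d) (R : realType) (P : probability T R).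

(** Given the unordered sample, [W] is a fixed set and the indices in [I] are
    drawn from it without replacement. *)
Lemma exchangeable_set_tail N (W : N.-tuple T -> {set 'I_N}) (I : {set 'I_N})
    (p t : R) :
  (forall k, measurable_fun setT (fun D => k \in W D)) ->
  (forall (s : 'S_N) D k, (k \in W (subsample s D)) = (s k \in W D)) ->
  (forall D, #|W D|%:R <= p * N%:R) -> 0 <= t ->
  (iid_law P N [set D | (#|I|%:R * (p + t) <= \sum_(i in I) (i \in W D)%:R)%R]
   <= (expR (- (2 * #|I|%:R * t ^+ 2)))%:E)%E.
Proof.
move=> mW Ws Wp t0; apply: iid_law_le_permutations.
  apply: measurable_fun_ler => //; rewrite (_ : (fun _ => _) =
    (fun D => \sum_(i <- enum I) (i \in W D)%:R));
      first exact: measurable_count.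
  by apply/funext => D; rewrite big_enum.
move=> D; apply: le_trans (hoeffding_without_replacement I (Wp D) t0).
rewrite ler_nat; apply: subset_leq_card; apply/fintype.subsetP => s;
  rewrite !inE.
by move=> h; apply: (le_trans h); apply: ler_sum => i _; rewrite Ws.
Qed.

End exchangeable_sets.

(** * Coverage of the inflated interval *)

Section inflated_coverage.
Context d (X : measurableType d) (R : realType) (P : probability (X * R)%type R)
  (A : regression_algorithm X R) (alpha : R).
Hypothesis symA : symmetric_algorithm A.
Hypothesis measA : jointly_measurable A.
Context (k m : nat).
Local Notation n := k.+1.
Local Notation N := (k.+1 + m)%N.
Local Notation T := ((k.+1 + m).-tuple (X * R)).

Definition train (D : T) : n.-tuple (X * R) := subsample (lshift m) D.

(** The indices, within the extended sample, of the training points used by the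
    [i]-th leave-one-out fit. *)
Definition others (i : 'I_n) : {set 'I_N} :=
  [set lshift m l | l in ~: [set i]]%SET.

(** Both errors compare the fit on [others i], of size [n - 1], with a fit on
    [m] more points, and evaluate them at a point used by neither. *)
Definition unstable (eps : R) (i : 'I_n) (j : 'I_m) (D : T) : bool :=
  eps < instability A D (others i) (lshift m i) +
        instability A D (others i) (rshift n j).

Definition widely_unstable (eps s v : R) (D : T) : bool :=
  v * m%:R < \sum_j (s * n%:R < \sum_i (unstable eps i j D)%:R)%R%:R.

Lemma measurable_unstable eps i j : measurable_fun setT (unstable eps i j).
Proof.
apply: measurable_fun_ltr => //.
by apply: measurable_funD; exact: measurable_instability.
Qed.

Lemma measurable_widely_unstable eps s v :
  measurable_fun setT (widely_unstable eps s v).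
Proof.
apply: measurable_fun_ltr => //; apply: measurable_count => j.
apply: measurable_fun_ltr => //; apply: measurable_count => i.
exact: measurable_unstable.
Qed.

Lemma card_others i : #|others i| = k.
Proof.
rewrite card_imset; last exact: lshift_inj.
by rewrite cardsC1 card_ord.
Qed.

Lemma lshift_notin_others i : lshift m i \notin others i.
Proof.
apply/imsetP => -[l]; rewrite !inE => /eqP li /lshift_inj il.
by apply: li.
Qed.

Lemma rshift_notin_others i j : rshift n j \notin others i.
Proof.
by apply/imsetP => -[l _ /eqP]; rewrite eq_sym eq_lrshift.
Qed.

Lemma fit_train D i : fit A (train D) (~: [set i]) = fit A D (others i).
Proof. by apply: fit_subsample => //; exact: lshift_inj. Qed.

(** The [i]-th fit is within its two errors of the fits that define the
    residuals of the extended sample, and the inflation [eps] absorbs these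
    errors. *)
Lemma cmp_residual eps D i j :
  residual A (train D) i + eps <
    `|(tnth D (rshift n j)).2
      - fit A (train D) (~: [set i]) (tnth D (rshift n j)).1| ->
  ~~ unstable eps i j D ->
  residual A D (lshift m i) < residual A D (rshift n j).
Proof.
rewrite /unstable -leNgt /residual /instability fit_train tnth_mktuple.
set yi := (tnth D (lshift m i)).2; set yj := (tnth D (rshift n j)).2.
set a := fit A D (others i) _; set b := fit A D (others i) _.
set a' := fit A D (~: _) _; set b' := fit A D (~: _) _.
have h1 := ler_distD a yi a'; have h2 := ler_distD b' yj b.
rewrite [`|b' - b|]distrC in h2; lra.
Qed.

Lemma residuals_subsample (s : 'S_N) D :
  residual A (subsample s D) = (fun i => residual A D (s i)).
Proof. by apply/funext => i; exact: residual_subsample. Qed.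

Lemma measurable_upper p l :
  measurable_fun setT (fun D : T => l \in upper p (residual A D)).
Proof.
rewrite (_ : (fun D => _) =
    fun D : T => (1 - p) * N%:R <= rank (residual A D) l); last first.
  by apply/funext => D; rewrite inE.
apply: measurable_fun_ler => //; apply: measurable_count => i.
by apply: measurable_fun_ltr; exact: measurable_residual.
Qed.

Lemma measurable_lower p l :
  measurable_fun setT (fun D : T => l \in lower p (residual A D)).
Proof.
rewrite (_ : (fun D => _) = fun D : T => [exists j,
    (j \notin upper p (residual A D)) && (residual A D l < residual A D j)]);
  last by apply/funext => D; rewrite inE.
apply: (measurable_exists R) => j; apply: measurable_and.
  by apply: measurable_neg; exact: measurable_upper.
by apply: measurable_fun_ltr; exact: measurable_residual.
Qed.

Definition over_represented_upper (p t : R) (D : T) : bool :=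
  m%:R * (p + t) <= \sum_j (rshift n j \in upper p (residual A D))%:R.

Definition over_represented_lower (p t : R) (D : T) : bool :=
  n%:R * (Num.max 0 (1 - p) + t)
    <= \sum_i (lshift m i \in lower p (residual A D))%:R.

Lemma measurable_over_represented p t :
  measurable_fun setT (over_represented_upper p t) /\
  measurable_fun setT (over_represented_lower p t).
Proof.
split; apply: measurable_fun_ler => //; apply: measurable_count => i.
  exact: measurable_upper.
exact: measurable_lower.
Qed.

Lemma over_represented_upper_tail p t : 0 <= p -> 0 <= t ->
  (iid_law P N [set D | over_represented_upper p t D]
   <= (expR (- (2 * m%:R * t ^+ 2)))%:E)%E.
Proof.
move=> p0 t0.
have := @exchangeable_set_tail _ _ _ P N (fun D => upper p (residual A D))
  [set rshift n j | j in 'I_m]%SET p t (measurable_upper p).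
rewrite card_imset ?card_ord; last exact: rshift_inj.
move=> /(_ _ _ t0); rewrite
  (_ : mkset _ = [set D | over_represented_upper p t D]).
  apply=> [s D l|D]; first by rewrite residuals_subsample upper_perm.
  exact: card_upper.
apply/seteqP; split=> D /=;
  rewrite /over_represented_upper big_imset//= ?big_mkcond//;
  by move=> ? ? _ _; exact: rshift_inj.
Qed.

Lemma over_represented_lower_tail p t : 0 <= t ->
  (iid_law P N [set D | over_represented_lower p t D]
   <= (expR (- (2 * n%:R * t ^+ 2)))%:E)%E.
Proof.
move=> t0.
have := @exchangeable_set_tail _ _ _ P N (fun D => lower p (residual A D))
  [set lshift m i | i in 'I_n]%SET (Num.max 0 (1 - p)) t (measurable_lower p).
rewrite card_imset ?card_ord; last exact: lshift_inj.
move=> /(_ _ _ t0); rewrite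
  (_ : mkset _ = [set D | over_represented_lower p t D]).
  apply=> [s D l|D]; first by rewrite residuals_subsample lower_perm.
  exact: card_lower.
apply/seteqP; split=> D /=;
  rewrite /over_represented_lower big_imset//= ?big_mkcond//;
  by move=> ? ? _ _; exact: lshift_inj.
Qed.

Definition miss_rate (eps : R) (E : n.-tuple (X * R)) : R :=
  fine (P [set z | miss A alpha eps E z]).

Lemma miss_rateE eps E :
  (miss_rate eps E)%:E = P [set z | miss A alpha eps E z].
Proof.
rewrite fineK//; apply: fin_num_measure; apply: measurable_event.
by have [] := measurable_miss alpha symA measA eps
  (measurable_cst E) (@measurable_id _ (X * R)%type setT).
Qed.

Lemma measurable_miss_rate eps : measurable_fun setT (miss_rate eps).
Proof.
apply: measurableT_comp => //; exact: measurable_miss_prob.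
Qed.

Definition under_counted (eps t : R) (D : T) : bool :=
  m%:R * (1 - miss_rate eps (train D) + t) <=
  \sum_j (~~ miss A alpha eps (train D) (tnth D (rshift n j)))%:R.

Lemma measurable_under_counted eps t : measurable_fun setT
  (under_counted eps t).
Proof.
have mtr : measurable_fun setT train by exact: measurable_subsample.
apply: measurable_fun_ler.
  apply: measurable_funM => //; apply: measurable_funD => //.
  apply: measurable_funB => //.
  exact: (measurableT_comp (measurable_miss_rate eps) mtr).
apply: measurable_count => j; apply: measurable_neg.
by have [] := measurable_miss alpha symA measA eps
  mtr (measurable_tnth (rshift n j)).
Qed.

(** The training sample being fixed by the Fubini-Tonelli theorem, the [m] other
    points are independent of it and each is missed with probability
    [miss_rate]. *)
Lemma under_counted_tail eps t : 0 <= t ->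
  (iid_law P N [set D | under_counted eps t D]
   <= (expR (- (2 * m%:R * t ^+ 2)))%:E)%E.
Proof.
move=> t0; set c := expR _.
rewrite -iid_law_cat; last by apply: measurable_event;
  exact: measurable_under_counted.
rewrite /product_measure1 /=.
apply: (@le_trans _ _ (\int[iid_law P n]_E (cst c%:E E))%E); last first.
  rewrite integral_cst// -[leRHS]mule1 lee_pmul//; last exact: probability_le1.
  by rewrite lee_fin expR_ge0.
have mQ : measurable (@tuple_cat _ _ n m @^-1` [set D | under_counted eps t D]).
  rewrite -[X in measurable X]setTI; apply: measurable_tuple_cat => //.
  by apply: measurable_event; exact: measurable_under_counted.
apply: ge0_le_integral => //.
- exact: measurable_fun_xsection.
- move=> E _.
  have mM : measurable_fun setT (fun z => miss A alpha eps E z).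
    by have [] := measurable_miss alpha symA measA eps
      (measurable_cst E) (@measurable_id _ (X * R)%type setT).
  apply: le_trans (@hoeffding_iid _ _ _ P (fun z => ~~ miss A alpha eps E z)
    m (1 - miss_rate eps E) t _ _ t0).
  + apply: le_of_eq; congr (iid_law P m _).
    apply/seteqP; split=> D; rewrite /xsection/= inE /= /under_counted;
      rewrite (_ : train _ = E) ?(eq_bigr _
        (fun j _ => congr1 (fun z => (~~ miss A alpha eps E z)%:R)
        (tnth_tuple_cat_r (E, D) j)))//;
      by apply: eq_from_tnth => i; rewrite tnth_mktuple tnth_tuple_cat_l.
  + exact: measurable_neg.
  + rewrite (_ : [set z | _] = ~` [set z | miss A alpha eps E z]).
      rewrite probability_setC; last exact: measurable_event.
      by rewrite -miss_rateE EFinB.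
    by apply/seteqP; split=> z /= /negP.
Qed.

(** Apart from the rare events, the miss rate is at most [t] above the fraction
    of the test points that are missed, which [count_miss_lt] bounds by [p + t +
    v]. *)
Lemma miss_rate_lt eps s t v D : 0 < alpha < 1 -> (0 < m)%N ->
  let p := alpha + s + t in
  ~~ over_represented_upper p t D -> ~~ over_represented_lower p t D ->
  ~~ under_counted eps t D -> ~~ widely_unstable eps s v D ->
  miss_rate eps (train D) < alpha + 3 * t + s + v.
Proof.
move=> /andP[_ alpha1] m0 p;
  rewrite /over_represented_upper /over_represented_lower.
rewrite /under_counted /widely_unstable -!ltNge -leNgt => hU hL hC hW.
have m0' : 0 < m%:R :> R by rewrite ltr0n.
have := @count_miss_lt R n m (residual A D) alpha s t v
  (fun i j => residual A (train D) i + eps < `|(tnth D (rshift n j)).2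
      - fit A (train D) (~: [set i]) (tnth D (rshift n j)).1|)
  (fun i j => unstable eps i j D)
  (fun j => miss A alpha eps (train D) (tnth D (rshift n j))) isT.
move=> /(_ _ _ hU hL hW) cM.
have {}cM : \sum_j (miss A alpha eps (train D) (tnth D (rshift n j)))%:R
    < m%:R * (p + t + v).
  apply: cM => [j /miss_count|i j].
    by apply: le_trans; exact: level_ge.
  exact: cmp_residual.
have cS : \sum_j (~~ miss A alpha eps (train D) (tnth D (rshift n j)))%:R
    + \sum_j (miss A alpha eps (train D) (tnth D (rshift n j)))%:R = m%:R :> R.
  rewrite -big_split/= (eq_bigr (fun=> 1)) ?sumr_const ?card_ord//.
  by move=> j _; case: (miss _ _ _ _ _); rewrite ?addr0 ?add0r.
have : m%:R * (miss_rate eps (train D)) < m%:R * (alpha + 3 * t + s + v).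
  move: hC cM cS; rewrite /p.
  set a := \sum_j _; set b := \sum_j _; set q := miss_rate _ _ => *; lra.
by rewrite ltr_pM2l.
Qed.

Lemma inflated_coverage eps s t v delta rho :
  0 < alpha < 1 -> (0 < m)%N -> 0 <= s -> 0 <= t ->
  expR (- (2 * n%:R * t ^+ 2)) <= delta ->
  expR (- (2 * m%:R * t ^+ 2)) <= delta ->
  (iid_law P N [set D | widely_unstable eps s v D] <= rho%:E)%E ->
  ((1 - 3 * delta - rho)%:E <= iid_law P n
    [set E | (P [set z | miss A alpha eps E z]
              < (alpha + 3 * t + s + v)%:E)%E])%E.
Proof.
move=> a01 m0 s0 t0 nd md rhoP; pose p := alpha + s + t.
have p0 : 0 <= p by case/andP: a01 => ? ?; rewrite /p; lra.
pose b1 := over_represented_upper p t; pose b2 := over_represented_lower p t.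
pose b3 := under_counted eps t; pose b4 := widely_unstable eps s v.
have [mb1 mb2] := measurable_over_represented p t.
have mb3 := measurable_under_counted eps t.
have mb4 := measurable_widely_unstable eps s v.
have mE (b : T -> bool) : measurable_fun setT b -> measurable [set D | b D].
  exact: measurable_event.
pose B := [set D | b1 D] `|` [set D | b2 D] `|` [set D | b3 D] `|`
  [set D | b4 D].
have m12 : measurable ([set D | b1 D] `|` [set D | b2 D]).
  by apply: measurableU; exact: mE.
have m123 : measurable ([set D | b1 D] `|` [set D | b2 D] `|` [set D | b3 D]).
  by apply: measurableU => //; exact: mE.
have mB : measurable B by apply: measurableU => //; exact: mE.
have PB : (iid_law P N B <= (3 * delta + rho)%:E)%E.
  rewrite (_ : 3 * delta + rho = delta + delta + delta + rho); last ring.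
  apply: (le_trans (measureU2 _ m123 (mE _ mb4))).
  rewrite EFinD leeD//; apply: (le_trans (measureU2 _ m12 (mE _ mb3))).
  rewrite EFinD leeD//; last first.
    by apply: (le_trans (under_counted_tail eps t0)); rewrite lee_fin.
  apply: (le_trans (measureU2 _ (mE _ mb1) (mE _ mb2))).
  rewrite EFinD leeD//.
    by apply: (le_trans (over_represented_upper_tail p0 t0)); rewrite lee_fin.
  by apply: (le_trans (over_represented_lower_tail p t0)); rewrite lee_fin.
set G := [set E | _]; have mG : measurable G.
  apply: (@measurable_event _ _ (fun E => (P [set z | miss A alpha eps E z]
              < (alpha + 3 * t + s + v)%:E)%E)).
  by apply: measurable_fun_lte => //; exact: measurable_miss_prob.
have <- : iid_law P N (train @^-1` G) = iid_law P n G.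
  by apply: iid_law_subsample => //; exact: lshift_inj.
apply: (@le_trans _ _ (iid_law P N (~` B))).
  by rewrite probability_setC// -addrA -opprD EFinB leeB.
apply: le_measure; rewrite ?inE//; first exact: measurableC.
  rewrite -[X in measurable X]setTI; exact: measurable_subsample.
move=> D nB /=; rewrite /G /= -miss_rateE lte_fin.
have [h1 h2 h3 h4] : [/\ ~~ b1 D, ~~ b2 D, ~~ b3 D & ~~ b4 D].
  by split; apply/negP => h; apply: nB; rewrite /B /=; tauto.
exact: (miss_rate_lt a01 m0 h1 h2 h3 h4).
Qed.

End inflated_coverage.

(** * From stability to the choice of the parameters *)

Section stability.
Context d (X : measurableType d) (R : realType) (P : probability (X * R)%type R)
  (A : regression_algorithm X R).
Hypothesis symA : symmetric_algorithm A.
Hypothesis measA : jointly_measurable A.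
Context (k m : nat).
Local Notation n := k.+1.
Local Notation N := (k.+1 + m)%N.
Local Notation T := ((k.+1 + m).-tuple (X * R)).

Lemma integral_unstable i (j : 'I_m) :
  (\int[iid_law P N]_D (instability A D (others m i) (lshift m i) +
     instability A D (others m i) (rshift n j))%:E
   = beta_out P A m k + beta_out P A m k)%E.
Proof.
under eq_integral do rewrite EFinD.
have mi (S : {set 'I_N}) l :
    measurable_fun setT (fun D : T => (instability A D S l)%:E).
  by apply/measurable_EFinP; exact: measurable_instability.
have i0 (S : {set 'I_N}) l (D : T) : (0 <= (instability A D S l)%:E)%E.
  by rewrite lee_fin instability_ge0.
rewrite ge0_integralD//.
congr (_ + _)%E; apply: (integral_instability symA measA P) => //;
  rewrite ?card_others ?lshift_notin_others ?rshift_notin_others//.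
Qed.

Lemma prob_unstable_le eps i j : 0 <= eps ->
  (eps%:E * iid_law P N [set D | unstable A eps i j D]
   <= beta_out P A m k + beta_out P A m k)%E.
Proof.
move=> eps0; rewrite -(integral_unstable i j); apply: markov_event => //.
- exact: measurable_unstable.
- apply/measurable_EFinP; apply: measurable_funD; exact: measurable_instability.
- by move=> D; rewrite lee_fin addr_ge0 ?instability_ge0.
- by move=> D; rewrite lee_fin => /ltW.
Qed.

Lemma prob_unstable_eq0 i j : beta_out P A m k = 0%E ->
  iid_law P N [set D | unstable A 0 i j D] = 0%E.
Proof.
move=> b0; have := integral_unstable i j; rewrite b0 adde0.
pose g (D : T) := (instability A D (others m i) (lshift m i) +
  instability A D (others m i) (rshift n j))%:E.
rewrite -/g => ig0.
have mg : measurable_fun setT g.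
  by apply/measurable_EFinP; apply: measurable_funD;
    exact: measurable_instability.
have /(ae_eq_integral_abs _ measurableT mg)[M [mM M0 gM]] :
    (\int[iid_law P N]_D `|g D| = 0)%E.
  rewrite -[RHS]ig0; apply: eq_integral => D _; rewrite gee0_abs//.
  by rewrite lee_fin addr_ge0 ?instability_ge0.
apply: (subset_measure0 _ mM _ M0).
  by apply: measurable_event; exact: measurable_unstable.
move=> D /= uD; apply: gM => /= /(_ I) [] gD0.
by move: uD; rewrite /unstable gD0 ltxx.
Qed.

(** Markov's inequality for the number of the unstable pairs. *)
Lemma prob_widely_unstable_le eps s v (c rho : R) :
  0 <= c -> (forall D : T, widely_unstable A eps s v D ->
    c <= \sum_(j < m) \sum_(i < n) (unstable A eps i j D)%:R) ->
  (forall i j, iid_law P N [set D | unstable A eps i j D] <= rho%:E)%E ->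
  (c%:E * iid_law P N [set D | widely_unstable A eps s v D]
   <= (m%:R * n%:R * rho)%:E)%E.
Proof.
move=> c0 cw urho.
have mu (i : 'I_n) (j : 'I_m) : measurable_fun setT
  (@unstable _ _ _ A k m eps i j).
  exact: measurable_unstable.
have mu' (i : 'I_n) (j : 'I_m) : measurable_fun setT
  (fun D : T => ((unstable A eps i j D)%:R : R)%:E).
  by apply/measurable_EFinP; apply: measurable_natr; exact: mu.
apply: (@le_trans _ _ (\int[iid_law P N]_D
    (\sum_(j < m) \sum_(i < n) ((unstable A eps i j D)%:R : R)%:E))%E).
  apply: markov_event => //.
  - exact: measurable_widely_unstable.
  - by apply: emeasurable_sum => j; apply: emeasurable_sum => i; exact: mu'.
  - by move=> D; do 2 (apply: sume_ge0 => ? _); rewrite lee_fin.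
  - move=> D /cw; rewrite -lee_fin => /le_trans; apply.
    by rewrite -sumEFin; apply: lee_sum => j _; rewrite -sumEFin.
rewrite ge0_integral_sum//; last 2 first.
- by move=> j; apply: emeasurable_sum => i; exact: mu'.
- by move=> j D _; apply: sume_ge0 => i _; rewrite lee_fin.
apply: (@le_trans _ _ (\sum_(j < m) \sum_(i < n) rho%:E)%E).
  apply: lee_sum => j _; rewrite ge0_integral_sum//.
  apply: lee_sum => i _; apply: le_trans (urho i j).
  by apply/le_of_eq/esym; exact: measure_event.
rewrite (eq_bigr (fun=> (n%:R * rho)%:E)) => [|j _].
  rewrite sumEFin sumr_const card_ord lee_fin -[leLHS]mulr_natl mulrA.
  exact: lexx.
by rewrite sumEFin sumr_const card_ord -[in LHS]mulr_natl.
Qed.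

End stability.

Section parameters.
Context {R : realType}.

Lemma fourth_root (c : R) : 0 <= c -> (c `^ 4^-1) ^+ 4 = c.
Proof.
move=> c0; rewrite -powR_mulrn ?powR_ge0// -powRrM mulVf ?powRr1//.
Qed.

(** The radius for which Hoeffding's bound is at most [delta] both for [n] and
    for [m] draws. *)
Lemma hoeffding_radius (n m : nat) (delta : R) : (0 < n)%N -> (0 < m)%N ->
  0 < delta < 1 ->
  let t := Num.sqrt (ln (1 / delta) / (2 * (minn n m)%:R)) in
  expR (- (2 * n%:R * t ^+ 2)) <= delta /\
  expR (- (2 * m%:R * t ^+ 2)) <= delta.
Proof.
move=> n0 m0 /andP[d0 d1] t.
have L0 : 0 <= ln (1 / delta) by rewrite ln_ge0// ler_pdivlMr// mul1r ltW.
have k0 : 0 < (minn n m)%:R :> R by rewrite ltr0n leq_min n0.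
have t2 : 2 * (minn n m)%:R * t ^+ 2 = ln (1 / delta).
  rewrite sqr_sqrtr; last by rewrite divr_ge0// mulr_ge0// ltW.
  by rewrite mulrC divfK// mulf_neq0// gt_eqF.
suff key (l : nat) : (minn n m <= l)%N -> expR (- (2 * l%:R * t ^+ 2)) <= delta.
  by split; apply: key; rewrite ?geq_minl ?geq_minr.
move=> ml; rewrite -[leRHS]lnK ?posrE// ler_expR lerNl.
rewrite -lnV ?posrE// -[delta^-1]mul1r -t2.
by rewrite ler_wpM2r ?sqr_ge0// ler_wpM2l// ler_nat.
Qed.

End parameters.

Theorem theorem3p3 (d : measure_display) (X : measurableType d) (R : realType)
  (P : probability (X * R)%type R) (A : regression_algorithm X R)
  (alpha : R) (n : nat) (f : X -> R -> R)
  (alpha01 : 0 < alpha < 1)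
  (symA : symmetric_algorithm A) (measA : jointly_measurable A)
  (n_ge1 : (1 <= n)%N)
  (densf : conditional_density P f)
  (meas_sup : measurable_fun setT (sup_density f)) :
  forall (m : nat) (delta : R), (1 <= m)%N -> 0 < delta < 1 ->
  (iid_law P n
     [set D | miscoverage P A alpha D
              < (alpha + 3 * Num.sqrt (ln (1 / delta) / (2 * (minn n m)%:R)))%:E
                + 4%:E * ((2%:E * B_dens P f * beta_out P A m n.-1) `^ 4^-1)]
   >= (1 - 3 * delta)%:E
      - (2%:E * B_dens P f * beta_out P A m n.-1) `^ 4^-1)%E.
Proof.
move=> m delta m0 d01; case: n n_ge1 => [//|k] _ /=.
have [nd md] := @hoeffding_radius R k.+1 m delta isT m0 d01.
set t := Num.sqrt _ in nd md *; set B := B_dens P f;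
  set beta := beta_out P A m k.
have t0 : 0 <= t := sqrtr_ge0 _.
have /andP[alpha0 alpha1] := alpha01.
have B0 : (0 < B)%E := B_dens_gt0 densf meas_sup.
have beta0 : (0 <= beta)%E by apply: integral_ge0 => p _; rewrite lee_fin.
have inv4 : 4^-1 != 0 :> R by rewrite invr_neq0.
(* The conclusion for the inflated interval, with room for the inflation. *)
have reduce (eps s v rho : R) : 0 <= eps -> 0 <= s ->
    (iid_law P (k.+1 + m) [set D | widely_unstable A eps s v D] <= rho%:E)%E ->
    forall g : R, ((s + v)%:E + 2%:E * (eps%:E * B) <= (4 * g)%:E)%E ->
    ((1 - 3 * delta - rho)%:E <= iid_law P k.+1
      [set D | (miscoverage P A alpha D
              < (alpha + 3 * t)%:E + 4%:E * g%:E)%E])%E.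
  move=> eps0 s0 wP g gP.
  apply: (le_trans (inflated_coverage symA measA alpha01 m0 s0 t0 nd md wP)).
  have mm e := measurable_miss_prob alpha symA measA P e (n := k.+1).
  apply: le_measure; rewrite ?inE.
  - apply: (@measurable_event _ _ (fun E => (P [set z | miss A alpha eps E z]
              < (alpha + 3 * t + s + v)%:E)%E)).
    exact: measurable_fun_lte.
  - rewrite (_ : [set D | _] = [set D | (P [set z | miss A alpha 0 D z]
              < (alpha + 3 * t)%:E + 4%:E * g%:E)%E]).
      apply: (@measurable_event _ _ (fun D => (P [set z | miss A alpha 0 D z]
              < (alpha + 3 * t)%:E + 4%:E * g%:E)%E)).
      exact: measurable_fun_lte.
    by apply/seteqP; split=> D /=; rewrite miscoverageE.
  move=> D /= lt1; rewrite miscoverageE//.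
  apply: (le_lt_trans (miscoverage_le_inflated symA measA alpha1 D
    densf meas_sup isT eps0)).
  have x0 : (0 <= 2%:E * (eps%:E * B))%E.
    by rewrite !mule_ge0// ?lee_fin// ltW.
  move: x0 gP; rewrite -/B; case: (2%:E * (eps%:E * B))%E => [x| |]// _ gP.
  apply: (@lt_le_trans _ _ ((alpha + 3 * t + s + v)%:E + x%:E)%E).
    by rewrite lteD2rE.
  by move: gP; rewrite -!EFinM -!EFinD !lee_fin; lra.
(* All the parameters vanish: the errors are null almost surely. *)
have [b0|bn] := eqVneq beta 0%E.
  rewrite b0 mule0 poweR0r// sube0.
  have := reduce 0 0 0 0 (lexx _) (lexx _).
  rewrite subr0; apply; last by rewrite addr0 mul0e mule0 adde0 mulr0.
  rewrite -[leLHS]mul1e.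
  have := @prob_widely_unstable_le _ _ _ P A symA measA k m 0 0 0 1 0 ler01.
  rewrite mulr0; apply => [D|i j]; last by rewrite prob_unstable_eq0.
  rewrite /widely_unstable mul0r => S0.
  pose K := (\sum_(j < m) \sum_(i < k.+1) unstable A 0 i j D)%N.
  have -> : \sum_(j < m) \sum_(i < k.+1) (unstable A 0 i j D)%:R
      = K%:R :> R.
    by rewrite natr_sum; apply: eq_bigr => j _; rewrite natr_sum.
  rewrite ler1n lt0n; apply: contraTneq S0 => /eqP.
  rewrite sum_nat_eq0 => /forallP K0; rewrite big1 ?ltxx// => j _.
  rewrite mul0r -natr_sum; have /eqP -> := K0 j.
  by rewrite ltxx.
have {bn beta0} beta_gt0 : (0 < beta)%E by rewrite lt_neqAle eq_sym bn.
have trivial : (2%:E * B * beta)%E = +oo%E ->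
    ((1 - 3 * delta)%:E - (2%:E * B * beta) `^ 4^-1 <= iid_law P k.+1 [set D |
    miscoverage P A alpha D < (alpha + 3 * t)%:E
      + 4%:E * ((2%:E * B * beta) `^ 4^-1)])%E.
  by move=> ->; rewrite poweRyr//; exact: leNye.
case EB : B B0 trivial => [b| |]//; last first.
  move=> _; apply.
  by rewrite gt0_muley ?lte_fin// gt0_mulye.
case Ebeta : beta beta_gt0 => [be| |]// be0 b0 trivial; last first.
  by apply: trivial; rewrite gt0_muley// mule_gt0// lte_fin.
rewrite !lte_fin in be0 b0.
have c0 : 0 < 2 * b * be by rewrite !mulr_gt0.
rewrite -!EFinM poweR_EFin; set g := (_ `^ _)%R.
have g0 : 0 < g by rewrite powR_gt0.
have g4 : g ^+ 4 = 2 * b * be by apply: fourth_root; exact: ltW.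
have gn0 : g != 0 by rewrite gt_eqF.
(* This [eps] makes the inflation cost [g], and an unstable pair has then a
   probability of at most [2 * g ^+ 3]. *)
rewrite -EFinB; apply: (reduce (be / g ^+ 3) g (2 * g) g).
- by rewrite divr_ge0 ?exprn_ge0 ?(ltW be0) ?(ltW g0).
- exact: ltW.
- have eps0 : 0 < be / g ^+ 3 by rewrite divr_gt0// exprn_gt0.
  have := @prob_widely_unstable_le _ _ _ P A symA measA k m (be / g ^+ 3) g
    (2 * g)
    ((2 * g * m%:R) * (g * k.+1%:R)) (2 * g ^+ 3).
  have mk0 : 0 < (2 * g * m%:R) * (g * k.+1%:R).
    by rewrite !mulr_gt0// ltr0n.
  move=> /(_ (ltW mk0)) wle.
  rewrite -(lee_pmul2l (erefl : (2 * g * m%:R * (g * k.+1%:R))%:E \is a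
    fin_num)) ?lte_fin//.
  rewrite -EFinM (_ : 2 * g * m%:R * (g * k.+1%:R) * g = m%:R * k.+1%:R *
    (2 * g ^+ 3)); last ring.
  apply: wle => [D wD|i j].
    apply: (@le_trans _ _ (g * k.+1%:R * \sum_(j < m)
        (g * k.+1%:R < \sum_i (unstable A (be / g ^+ 3) i j D)%:R)%R%:R)).
      by rewrite mulrC ler_wpM2l ?(ltW wD)// mulr_ge0 ?ltW.
    rewrite mulr_sumr; apply: ler_sum => j _.
    by case: ltP => [/ltW|_]; rewrite ?mulr1 ?mulr0// sumr_ge0.
  rewrite -(lee_pmul2l (erefl : (be / g ^+ 3)%:E \is a fin_num)) ?lte_fin//.
  apply: (le_trans (prob_unstable_le P symA measA i j (ltW eps0))).
  rewrite -/beta Ebeta -EFinD -EFinM lee_fin; apply: le_of_eq.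
  by field.
rewrite EB -!EFinM -!EFinD lee_fin; apply: le_of_eq.
have -> : be / g ^+ 3 * b = g / 2.
  have -> : be / g ^+ 3 * b = (be * b) / g ^+ 3 by rewrite mulrAC.
  have -> : be * b = g ^+ 4 / 2 by rewrite g4; field.
  by field.
lra.
Qed.
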